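(* Let $d=3$. On any tetrahedron $T\in\mathcal T$ the following statements hold. (a) The functions $\{\boldsymbol\psi_j^{\mathrm{RT}_0}\}_{j=1,2,3,4}$ and $\{\boldsymbol\psi_j^{\mathrm{RT}_1}\}_{j=1,2,3}\subset\widetilde{\boldsymbol{RT}}{}_1^{\rm int}(T)$ are linearly independent. For $\boldsymbol V_h^{\rm R}(T):=\mathrm{span}\{\boldsymbol\psi_j^{\mathrm{RT}_0}:j=1,2,3,4\}\oplus\mathrm{span}\{\boldsymbol\psi_j^{\mathrm{RT}_1}:j=1,2,3\}$, the restricted divergence operator $\mathrm{div}:\boldsymbol V_h^{\rm R}(T)\to P_1(T)$ is surjective (but not bijective). (b) The functions $\{\boldsymbol\psi_j^{\mathrm{RT}_1}\}_{j=1,2,3}\subset\widetilde{\boldsymbol{RT}}{}_1^{\rm int}(T)$ and $$\boldsymbol\psi_{(j,k)}^{\mathrm{RT}_2}:=(6\varphi_j-1)\boldsymbol\psi_k^{\mathrm{RT}_1}+(6\varphi_k-1)\boldsymbol\psi_j^{\mathrm{RT}_1}\in\widetilde{\boldsymbol{RT}}{}_2^{\rm int}(T),\qquad (j,k)\in\mathcal S,$$ with $\mathcal S=\{(1,2),(1,3),(1,4),(2,3),(2,4),(3,4)\}$ are linearly independent, and $$\int_T\mathrm{div}(\boldsymbol\psi_j^{\mathrm{RT}_1})\,d\boldsymbol x=0\ \ (j=1,2,3),\qquad \int_T\mathrm{div}(\boldsymbol\psi_{(j,k)}^{\mathrm{RT}_2})\,d\boldsymbol x=0\ \ ((j,k)\in\mathcal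 S).$$ For $\boldsymbol V_h^{\rm R}(T):=\mathrm{span}\{\boldsymbol\psi_j^{\mathrm{RT}_1}:j=1,2,3\}\oplus\mathrm{span}\{\boldsymbol\psi_{(j,k)}^{\mathrm{RT}_2}:(j,k)\in\mathcal S\}$, the restricted divergence operator $\mathrm{div}:\boldsymbol V_h^{\rm R}(T)\to\widehat Q_h^\perp(T)$ for $\widehat Q_h(T)=P_0(T)$, i.e. $\widehat Q_h^\perp(T)=\{q\in P_2(T):(q,r)_T=0\ \forall r\in P_0(T)\}$, is bijective.
   Context: $\mathcal T$ is a regular simplicial triangulation of a bounded polyhedral Lipschitz domain in $\mathbb R^d$. $P_k(T)$ denotes polynomials of degree $\le k$ on $T$, $\boldsymbol P_k(T)$ vector-valued ones, and $(\cdot,\cdot)_T$ the $L^2(T)$ inner product. A simplex $T\in\mathcal T$ has vertices $\boldsymbol P_j$, $j=1,\dots,d+1$, and $\varphi_j$ is the nodal (barycentric) basis function of $\boldsymbol P_j$, i.e. the affine function with $\varphi_j(\boldsymbol P_k)=\delta_{jk}$. Set $$\boldsymbol\psi_j^{\mathrm{RT}_0}:=\frac1{d|T|}(\boldsymbol x-\boldsymbol P_j),\qquad \boldsymbol\psi_j^{\mathrm{RT}_1}:=\varphi_j\,\boldsymbol\psi_j^{\mathrm{RT}_0},\qquad j=1,\dots,d+1.$$ $\boldsymbol{RT}_m(T)=\{\boldsymbol p+q\boldsymbol x:\boldsymbol p\in\boldsymbol P_m(T),q\in P_m(T)\}$, $\boldsymbol{RT}_m^{\rm int}(T)=\{\boldsymbol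 v\in\boldsymbol{RT}_m(T):\boldsymbol v\cdot\boldsymbol n_T=0\text{ on }\partial T\}$, where $\boldsymbol n_T$ is the outer unit normal. $\widetilde{\boldsymbol{RT}}{}_m^{\rm int}(T)$ denotes an arbitrary but fixed complement in $\boldsymbol{RT}_m^{\rm int}(T)$ of its subspace of divergence-free functions (not unique in general); it is required that the spaces $\widetilde{\boldsymbol{RT}}{}_m^{\rm int}(T)$, $T\in\mathcal T$, are all connected to one and the same reference space via Piola's transformation. One has $\widetilde{\boldsymbol{RT}}{}_1^{\rm int}(T)=\boldsymbol{RT}_1^{\rm int}(T)$. In (b), $\widehat Q_h^\perp(T)$ is the $L^2(T)$-orthogonal complement of $\widehat Q_h(T)$ in $P_2(T)$.
   Formalization: The membership of the RT_2 functions in the complement of degree 2 is stated as: some admissible choice of complements (Piola images of one reference space) contains them for all T; for an arbitrary fixed complement it is false, since one may add a divergence-free field to a basis function. *)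

(* Defs.v *)
From HB Require Import structures.
From mathcomp Require Import all_boot all_order all_algebra.
From mathcomp Require Import ring.
From mathcomp Require Import all_classical all_reals all_analysis.
(* The notations of mpoly are incompatible with those of MathComp-Analysis. *)
From mathcomp Require Import -(notations) mpoly.

Set Implicit Arguments.
Unset Strict Implicit.
Unset Printing Implicit Defensive.

Import Order.TTheory GRing.Theory Num.Theory.
Import numFieldNormedType.Exports.
Local Open Scope classical_set_scope.
Local Open Scope ring_scope.

(* Points of R^3 are row vectors; vertices and coordinates are numbered from 0,
   not from 1.  The spaces P_k(T) and RT_m(T) consist of polynomial functions;
   as T has nonempty interior, each of them is determined by its values on T and
   is represented here by its unique polynomial extension to R^3. *)

Section Space.
Variable R : realType.
Local Notation E := 'rV[R]_3.
Implicit Types (f g q : E -> R) (v w : E -> E).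

Definition dot (x y : E) : R := (x *m y^T) 0 0.

Definition div v : E -> R :=
  fun x => \sum_(i < 3) 'D_('e_i) (fun y => v y 0 i : R) x.

(* Lebesgue measure on R^3, carried by (R * R) * R. *)
Definition vec3 (p : R * R * R) : E := \row_(i < 3) [:: p.1.1; p.1.2; p.2]`_i.

Definition leb3 :=
  ((lebesgue_measure (R := R) \x lebesgue_measure (R := R))
     \x lebesgue_measure (R := R))%E.

Definition integral3 (A : set E) f : R :=
  \int[leb3]_(p in vec3 @^-1` A) f (vec3 p).

Definition volume (A : set E) : R := fine (leb3 (vec3 @^-1` A)).

Definition is_subspace (A : set (E -> E)) : Prop :=
  A 0 /\ forall (a : R) v w, A v -> A w -> A (a *: v + w).

Definition set_add (A B : set (E -> E)) : set (E -> E) :=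
  [set w | exists u v, [/\ A u, B v & w = u + v]].

Definition lin_span (s : seq (E -> E)) : set (E -> E) :=
  [set v | exists c : 'I_(size s) -> R, v = \sum_i c i *: s`_i].

Definition lin_indep_on (A : set E) (s : seq (E -> E)) : Prop :=
  forall c : 'I_(size s) -> R,
    (forall x, A x -> \sum_i c i *: s`_i x = 0) -> forall i, c i = 0.

Definition is_complement (X Z W : set (E -> E)) : Prop :=
  [/\ is_subspace W, W `<=` X, W `&` Z = [set 0] & set_add W Z = X].

(* P_k: [msize p] is the total degree of p plus one, and 0 if p = 0. *)
Definition Pk (k : nat) : set (E -> R) :=
  [set f | exists2 p : mpoly 3 R, (mmeasure mdeg p <= k.+1)%N
         & forall x : E, f x = meval (fun i => x 0 i) p].

Definition RT (m : nat) : set (E -> E) :=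
  [set v | exists (p : E -> E) (q : E -> R),
     [/\ forall i, Pk m (fun x => p x 0 i), Pk m q
       & forall x, v x = p x + q x *: x]].

Definition edge_mx (P : 'I_4 -> E) : 'M[R]_3 :=
  \matrix_(i < 3) (P (lift ord0 i) - P ord0).

Record tetrahedron := Tetrahedron {
  vertex :> 'I_4 -> E ;
  edge_unitmx : edge_mx vertex \in unitmx }.

Implicit Type T : tetrahedron.

Definition hull (P : 'I_4 -> E) (J : pred 'I_4) : set E :=
  [set x | exists c : 'I_4 -> R,
     [/\ forall j, 0 <= c j, forall j, ~~ J j -> c j = 0, \sum_j c j = 1
       & x = \sum_j c j *: P j]].

Definition body T : set E := hull T predT.

Definition face T (i : 'I_4) : set E := hull T (predC1 i).

(* n is the outer unit normal to the face opposite to vertex i; the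
   nondegeneracy of T makes it unique, and it always exists. *)
Definition outer_unit_normal T (i : 'I_4) (n : E) : Prop :=
  [/\ dot n n = 1,
      forall j k, j != i -> k != i -> dot (T j - T k) n = 0
    & forall j, j != i -> dot (T i - T j) n < 0].

Definition RTint (m : nat) T : set (E -> E) :=
  [set v | RT m v /\ forall i n, outer_unit_normal T i n ->
                       forall x, face T i x -> dot (v x) n = 0].

Definition divfree : set (E -> E) := [set v | forall x, div v x = 0].

(* The last three barycentric coordinates of x are the coordinates of x - P_0
   in the basis of edges P_i - P_0. *)
Definition bary T (j : 'I_4) (x : E) : R :=
  let l := (x - T ord0) *m invmx (edge_mx T) in
  if unlift ord0 j is Some i then l 0 i else 1 - \sum_i l 0 i.

(* The next two lemmas determine the barycentric functions uniquely. *)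
Lemma bary_vertex T j k : bary T j (T k) = (j == k)%:R.
Proof.
have edgeE i : (T (lift ord0 i) - T ord0) *m invmx (edge_mx T) = 'e_i.
  have -> : T (lift ord0 i) - T ord0 = row i (edge_mx T) by rewrite rowK.
  by rewrite -row_mul mulmxV ?edge_unitmx // row1.
rewrite /bary; case: (unliftP ord0 k) => [i|] -> {k}.
  rewrite edgeE; case: unliftP => [i'|] -> {j}.
    by rewrite mxE eqxx (inj_eq lift_inj).
  rewrite (bigD1 i) //= big1 => [|i' /negPf ne]; rewrite !mxE ?eqxx ?ne //.
  by rewrite addr0 subrr.
rewrite subrr mul0mx; case: unliftP => [i'|] -> {j}; first by rewrite mxE.
by rewrite big1 ?subr0 // => i _; rewrite mxE.
Qed.

Lemma bary_affine T j (a : R) (x y : E) :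
  bary T j (a *: x + (1 - a) *: y) = a * bary T j x + (1 - a) * bary T j y.
Proof.
rewrite /bary; have -> : a *: x + (1 - a) *: y - T ord0 =
    a *: (x - T ord0) + (1 - a) *: (y - T ord0).
  rewrite !scalerBr addrACA -opprD -scalerDl addrCA subrr addr0.
  by rewrite scale1r.
rewrite mulmxDl -!scalemxAl; case: unlift => [i|]; first by rewrite !mxE.
under eq_bigr => i _ do rewrite mxE [X in X + _]mxE [X in _ + X]mxE.
by rewrite big_split -!mulr_sumr /=; ring.
Qed.

Definition psi0 T (j : 'I_4) : E -> E :=
  fun x => (3 * volume (body T))^-1 *: (x - T j).

Definition psi1 T (j : 'I_4) : E -> E := fun x => bary T j x *: psi0 T j x.

Definition psi2 T (p : 'I_4 * 'I_4) : E -> E := fun x =>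
  (6 * bary T p.1 x - 1) *: psi1 T p.2 x + (6 * bary T p.2 x - 1) *: psi1 T p.1 x.

(* Vertices of the unit simplex: the origin and the three unit vectors. *)
Definition unit_vertex (j : 'I_4) : E :=
  if unlift ord0 j is Some i then 'e_i else 0.

Lemma unit_edge_unitmx : edge_mx unit_vertex \in unitmx.
Proof.
suff -> : edge_mx unit_vertex = 1%:M by rewrite unitmx1.
apply/row_matrixP => i.
by rewrite rowK row1 /unit_vertex liftK unlift_none subr0.
Qed.

Definition unit_tetrahedron : tetrahedron := Tetrahedron unit_edge_unitmx.

(* Piola's transformation for the affine map x |-> P_0 + x *m edge_mx T from the
   unit simplex to T; points being rows, the Jacobian matrix B of that map acts
   as right multiplication by edge_mx T. *)
Definition piola T v : E -> E := fun x =>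
  `|\det (edge_mx T)|^-1 *:
    (v ((x - T ord0) *m invmx (edge_mx T)) *m edge_mx T).

(* The admissible choices of the complements of the divergence-free functions
   in RT_m^int(T), for T in the mesh M: they all are Piola images of one and the
   same space on the reference simplex. *)
Definition admissible_complements (M : set tetrahedron) (m : nat)
    (W : tetrahedron -> set (E -> E)) : Prop :=
  (forall T, M T -> is_complement (RTint m T) (RTint m T `&` divfree) (W T)) /\
  exists What : set (E -> E),
    is_complement (RTint m unit_tetrahedron)
      (RTint m unit_tetrahedron `&` divfree) What /\
    forall T, M T -> W T = piola T @` What.

Definition L2dot T f g : R := integral3 (body T) (fun x => f x * g x).

Definition Qperp T (Q : set (E -> R)) : set (E -> R) :=
  [set q | Pk 2 q /\ forall r, Q r -> L2dot T q r = 0].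

Definition idx3 : seq 'I_4 := [:: 0; 1; 2].
Definition idx4 : seq 'I_4 := [:: 0; 1; 2; 3].
Definition idxS : seq ('I_4 * 'I_4) :=
  [:: (0, 1); (0, 2); (0, 3); (1, 2); (1, 3); (2, 3)].

Definition RT0s T := [seq psi0 T j | j <- idx4].
Definition RT1s T := [seq psi1 T j | j <- idx3].
Definition RT2s T := [seq psi2 T p | p <- idxS].

End Space.

(* Main.v *)
Require Import Defs.
From HB Require Import structures.
From mathcomp Require Import all_boot all_order all_algebra.
From mathcomp Require Import ring lra.
From mathcomp Require Import all_classical all_reals all_analysis.
From mathcomp Require Import measurable_realfun.
From mathcomp Require Import -(notations) mpoly.

Set Implicit Arguments.
Unset Strict Implicit.
Unset Printing Implicit Defensive.

Import Order.TTheory GRing.Theory Num.Theory.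
Import numFieldNormedType.Exports.
Local Open Scope classical_set_scope.
Local Open Scope ring_scope.

(** The divergences of the fields are explicit in barycentric coordinates: with
    V the volume of T and l_j the barycentric coordinates,

      div psi1_j = (4 l_j - 1) / (3 V),
      div psi2_(j,k) = (60 l_j l_k - 10 l_j - 10 l_k + 2) / (3 V).

    A quadratic polynomial is an affine function plus a combination of the six
    edge bubbles l_j l_k, so the coefficients of the psi2 can be read off from the
    bubbles of a given divergence, and those of the three psi1 from its vertex
    values; hence div is injective on the space of part (b). Matching the bubbles
    and vertex values of a prescribed quadratic polynomial leaves one linear
    condition on it, which says that its mean value is zero. Part (a) is the same
    argument in degree one, where all the psi0 have the same divergence, which
    destroys injectivity.

    The mean values come from the moments of the l_j. They are obtained without a
    change of variables for general affine maps: the part of T where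
    l_j >= 1 - r is the image of T under the homothety of ratio r centred at the
    j-th vertex, and homotheties rescale each Cartesian coordinate separately.
    Comparing the integral of l_j g over T with the one over this part, for a
    density g homogeneous of degree k about that vertex, and letting r tend to 1
    gives (k + 4) * integral (l_j g) = integral g ([moment_recursion]).

    The spaces RT_m^int are described by [RTint_decomp]: if v = p + q x has no
    normal flux, then its component along the gradient of l_i is a polynomial of
    degree m plus q l_i, so that polynomial vanishes on the i-th face and is
    divisible by l_i; solving for q gives v = sum_i f_i l_i (x - P_i) with f_i of
    degree m - 1. For m = 1 the f_i are constants and a divergence-free v
    vanishes, so every complement is the whole space. For m = 2 all divergences
    have mean zero by the moments; by the bijectivity in (b), the span of the psi1
    and psi2 is then a complement of the divergence-free fields on every T. These
    spans correspond to each other under Piola's transformation, which is the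
    choice of complements asserted to exist. *)

(** * Barycentric coordinates and normals *)

Section Barycentric.
Variable R : realType.
Local Notation E := 'rV[R]_3.
Implicit Types (T : tetrahedron R) (i j k : 'I_4) (x y n : E).

Lemma dotE x y : dot x y = \sum_(i < 3) x 0 i * y 0 i.
Proof. by rewrite /dot mxE; apply: eq_bigr => i _; rewrite mxE. Qed.

Lemma dotDl x y n : dot (x + y) n = dot x n + dot y n.
Proof. by rewrite /dot mulmxDl mxE. Qed.

Lemma dotZl (a : R) x n : dot (a *: x) n = a * dot x n.
Proof. by rewrite /dot -scalemxAl mxE. Qed.

Lemma dot0l n : dot 0 n = 0.
Proof. by rewrite /dot mul0mx mxE. Qed.

Lemma dotNl x n : dot (- x) n = - dot x n.
Proof. by rewrite /dot mulNmx mxE. Qed.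

Lemma dot_suml (I : finType) (F : I -> E) n :
  dot (\sum_i F i) n = \sum_i dot (F i) n.
Proof.
elim/big_ind2: _ => [|x a y b <- <-|//]; first exact: dot0l.
by rewrite dotDl.
Qed.

Lemma dotC x y : dot x y = dot y x.
Proof. by rewrite !dotE; apply: eq_bigr => i _; rewrite mulrC. Qed.

Definition bary_grad T j : E :=
  if unlift ord0 j is Some i then (col i (invmx (edge_mx T)))^T
  else - \sum_i (col i (invmx (edge_mx T)))^T.

Lemma bary_diff T j x y :
  bary T j x - bary T j y = dot (x - y) (bary_grad T j).
Proof.
have dcol (i : 'I_3) : dot (x - y) (col i (invmx (edge_mx T)))^T =
    ((x - T ord0) *m invmx (edge_mx T)) 0 i -
    ((y - T ord0) *m invmx (edge_mx T)) 0 i.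
  rewrite /dot trmxK colE mulmxA -colE mxE.
  have -> : x - y = (x - T ord0) - (y - T ord0) by rewrite opprB addrA subrK.
  by rewrite mulmxBl !mxE.
rewrite /bary /bary_grad; case: unlift => [i|]; first by rewrite dcol.
rewrite opprB addrC addrA subrK -sumrB dotC dotNl dot_suml -sumrN.
by apply: eq_bigr => i _; rewrite dotC dcol opprB.
Qed.

Lemma sum_bary T x : \sum_j bary T j x = 1.
Proof.
rewrite big_ord_recl {1}/bary unlift_none.
by under [X in _ + X]eq_bigr => i _ do rewrite /bary liftK; rewrite subrK.
Qed.

Lemma bary_comb T j (c : 'I_4 -> R) :
  \sum_k c k = 1 -> bary T j (\sum_k c k *: T k) = c j.
Proof.
move=> c1; rewrite -[LHS](subrK (bary T j (T j))) bary_diff.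
have -> : \sum_k c k *: T k - T j = \sum_k c k *: (T k - T j).
  rewrite -{1}[T j]scale1r -c1 scaler_suml -sumrB.
  by apply: eq_bigr => k _; rewrite scalerBr.
rewrite dot_suml; under eq_bigr => k _.
  rewrite dotZl -bary_diff !bary_vertex eqxx; over.
rewrite bary_vertex eqxx /= -[X in _ + X = _]c1 -big_split /=.
rewrite (bigD1 j) //= eqxx subrr mulr0 add0r big1 ?addr0 // => k /negPf kj.
by rewrite eq_sym kj sub0r mulrN1 addNr.
Qed.

Lemma bary_point T x : x = \sum_j bary T j x *: T j.
Proof.
rewrite big_ord_recl {1}/bary unlift_none.
under [X in _ + X]eq_bigr => i _ do rewrite /bary liftK.
set l := (x - _) *m _.
have -> : x = T ord0 + l *m edge_mx T.
  by rewrite /l mulmxKV ?edge_unitmx // addrC subrK.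
have -> : l *m edge_mx T = \sum_i l 0 i *: (T (lift ord0 i) - T ord0).
  by rewrite mulmx_sum_row; apply: eq_bigr => i _; rewrite rowK.
rewrite scalerBl scale1r -addrA; congr (_ + _).
rewrite scaler_suml addrC -sumrB.
by apply: eq_bigr => i _; rewrite scalerBr.
Qed.

(** The vertices and the barycentric gradients are dual to each other, so a vector
    is recovered from its components along the gradients. *)
Lemma grad_decomp T x : x = \sum_j dot x (bary_grad T j) *: T j.
Proof.
transitivity (\sum_j bary T j x *: T j - \sum_j bary T j 0 *: T j).
  by rewrite -!bary_point subr0.
rewrite -sumrB.
by apply: eq_bigr => j _; rewrite -scalerBl bary_diff subr0.
Qed.

Lemma sum_dot_grad T x : \sum_j dot x (bary_grad T j) = 0.
Proof.
transitivity (\sum_j (bary T j x - bary T j 0)).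
  by apply: eq_bigr => j _; rewrite bary_diff subr0.
by rewrite sumrB !sum_bary subrr.
Qed.

Lemma dot_vertex T j k x :
  dot (x - T k) (bary_grad T j) = bary T j x - (j == k)%:R.
Proof. by rewrite -bary_diff bary_vertex. Qed.

Lemma bodyP T x : body T x <-> forall j, 0 <= bary T j x.
Proof.
split=> [[c [c0 _ c1 ->]] j|bx]; first by rewrite bary_comb.
exists (bary T ^~ x); split=> //; [exact: sum_bary|exact: bary_point].
Qed.

Lemma faceP T i x : face T i x <-> body T x /\ bary T i x = 0.
Proof.
split=> [[c [c0 ci c1 ->]]|[/bodyP bx xi]].
  split; first by apply/bodyP => j; rewrite bary_comb.
  by rewrite bary_comb // ci //= eqxx.
exists (bary T ^~ x); split=> // [j||]; [|exact: sum_bary|exact: bary_point].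
by rewrite /= negbK => /eqP ->.
Qed.

(** Both x and the j-th vertex lie in the i-th face. *)
Lemma face_tangent T i j x n : outer_unit_normal T i n -> face T i x -> j != i ->
  dot (x - T j) n = 0.
Proof.
move=> [_ tn _] /faceP[_ xi] ji.
have -> : x - T j = \sum_k bary T k x *: (T k - T j).
  under [RHS]eq_bigr => k _ do rewrite scalerBr.
  by rewrite sumrB -bary_point -scaler_suml sum_bary scale1r.
rewrite dot_suml big1 // => k _; rewrite dotZl.
by have [->|ki] := eqVneq k i; rewrite ?xi ?mul0r // tn ?mulr0.
Qed.

(** The gradient of a barycentric coordinate is an inner normal of the opposite
    face, so a field with vanishing normal traces is orthogonal to it there. *)
Lemma bary_grad_normal T i :
  exists2 a : R, a != 0 & outer_unit_normal T i (a *: bary_grad T i).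
Proof.
set g := bary_grad T i; pose k : 'I_4 := if i == ord0 then 1 else 0.
have ki : i != k by rewrite /k; case: (eqVneq i ord0) => [->|].
have g_neq0 : g != 0.
  apply: contra_eq_neq (bary_diff T i (T i) (T k)) => g0.
  by rewrite -/g g0 !bary_vertex eqxx (negPf ki) subr0 dotC dot0l oner_eq0.
have gg : 0 < dot g g.
  rewrite lt_neqAle eq_sym dotE sumr_ge0 ?andbT => [|h _]; last first.
    by rewrite -expr2 sqr_ge0.
  apply: contra g_neq0; rewrite psumr_eq0 => [/allP g0|h _]; last first.
    by rewrite -expr2 sqr_ge0.
  apply/eqP/rowP => h; rewrite mxE; apply/eqP.
  by have /= := g0 h (mem_index_enum _); rewrite -expr2 sqrf_eq0.
have s0 : 0 < Num.sqrt (dot g g) by rewrite sqrtr_gt0.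
have dotZr a x y : dot x (a *: y) = a * dot x y by rewrite dotC dotZl dotC.
exists (- (Num.sqrt (dot g g))^-1); first by rewrite oppr_eq0 invr_eq0 gt_eqF.
split.
- rewrite dotZl dotZr mulrA mulrNN -expr2 exprVn sqr_sqrtr ?(ltW gg) //.
  by rewrite mulVf // gt_eqF.
- move=> j l ji li; rewrite dotZr -bary_diff !bary_vertex.
  by rewrite ![i == _]eq_sym (negPf ji) (negPf li) subrr mulr0.
- move=> j ji; rewrite dotZr -bary_diff !bary_vertex eqxx eq_sym (negPf ji).
  by rewrite subr0 mulr1 oppr_lt0 invr_gt0.
Qed.

Lemma RTint_grad m T (v : E -> E) i x :
  RTint m T v -> face T i x -> dot (v x) (bary_grad T i) = 0.
Proof.
move=> [_ vn] fx; have [a a0 an] := bary_grad_normal T i.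
have := vn i _ an x fx; rewrite dotC dotZl dotC => /eqP.
by rewrite mulf_eq0 (negPf a0) => /eqP.
Qed.

End Barycentric.

(** * Polynomials in barycentric form *)

Section Polynomials.
Variable R : realType.
Local Notation E := 'rV[R]_3.
Implicit Types (T : tetrahedron R) (i j k : 'I_4) (x y : E) (f g : E -> R).
Implicit Types (p : 'I_4 * 'I_4).

Lemma Pk_cst m (c : R) : Pk m (fun _ : E => c).
Proof.
exists (mpolyC 3 c) => [|x]; last by rewrite mevalC.
by rewrite mmeasureC; case: (_ != _).
Qed.

Lemma Pk_coord m (h : 'I_3) : Pk m.+1 (fun x : E => x 0 h).
Proof.
exists (mpolyX R (mnm1 h)) => [|x]; last by rewrite mevalXU.
by rewrite mmeasureX /= mdeg1.
Qed.

Lemma PkD m f g : Pk m f -> Pk m g -> Pk m (fun x => f x + g x).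
Proof.
move=> [p pm fp] [q qm gq]; exists (p + q) => [|x].
  by rewrite (leq_trans (mmeasureD_le _ _ _)) // geq_max pm qm.
by rewrite mevalD fp gq.
Qed.

Lemma PkZ m (a : R) f : Pk m f -> Pk m (fun x => a * f x).
Proof.
move=> [p pm fp]; exists (a *: p) => [|x]; last by rewrite mevalZ fp.
by rewrite (leq_trans (mmeasureZ_le _ _ _)).
Qed.

Lemma PkB m f g : Pk m f -> Pk m g -> Pk m (fun x => f x - g x).
Proof.
move=> Pf Pg; have -> : (fun x => f x - g x) = (fun x => f x + (-1) * g x).
  by apply/funext => x; rewrite mulN1r.
by apply: PkD => //; apply: PkZ.
Qed.

Lemma Pk_sum m (I : Type) (s : seq I) (F : I -> E -> R) :
  (forall h, Pk m (F h)) -> Pk m (fun x => \sum_(h <- s) F h x).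
Proof.
move=> PF; elim: s => [|h s IH].
  by under eq_fun => x do rewrite big_nil; exact: Pk_cst.
by under eq_fun => x do rewrite big_cons; exact: PkD.
Qed.

Lemma PkM m n f g : Pk m f -> Pk n g -> Pk (m + n) (fun x => f x * g x).
Proof.
move=> [p pm fp] [q qn gq]; exists (p * q) => [|x]; last by rewrite mevalM fp gq.
have [->|p0] := eqVneq p 0; first by rewrite mul0r mmeasure0.
have [->|q0] := eqVneq q 0; first by rewrite mulr0 mmeasure0.
rewrite msizeM_proper ?mulf_neq0 ?mleadc_eq0 //.
by rewrite -subn1 leq_subLR add1n -addnS -addSn leq_add.
Qed.

Lemma Pk_le m n f : (m <= n)%N -> Pk m f -> Pk n f.
Proof. by move=> mn [p pm fp]; exists p => //; apply: leq_trans pm _. Qed.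

Lemma Pk_bary m T j : Pk m.+1 (bary T j).
Proof.
have -> : bary T j = (fun x => bary T j 0 +
    \sum_(i <- index_enum 'I_3) bary_grad T j 0 i * x 0 i).
  apply/funext => x; rewrite -[LHS](subrK (bary T j 0)) bary_diff subr0 addrC.
  by rewrite dotE; congr (_ + _); apply: eq_bigr => i _; rewrite mulrC.
apply: PkD; first exact: Pk_cst.
by apply: Pk_sum => i; apply: PkZ; exact: Pk_coord.
Qed.

(** Any graded family of function spaces that contains the constants and is
    closed under linear combinations, multiplication by a coordinate and raising
    of the degree contains the polynomials, monomial by monomial. *)
Lemma Pk_min (S : nat -> set (E -> R)) :
  (forall m, S m (fun=> 0)) ->
  (forall m (a : R) f g, S m f -> S m g -> S m (fun x => a * f x + g x)) ->
  S 0%N (fun=> 1) ->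
  (forall m (h : 'I_3) f, S m f -> S m.+1 (fun x => x 0 h * f x)) ->
  (forall m f, S m f -> S m.+1 f) ->
  forall m, Pk m `<=` S m.
Proof.
move=> S0 SD S1 SX Sle m f [p pm fp].
have Sn a b : (a <= b)%N -> S a `<=` S b.
  by move=> /subnK <-; elim: (b - a)%N => [//|n IH] h /IH; exact: Sle.
have Smon (mn : multinom 3) :
    S (mdeg mn) (fun x : E => \prod_i x 0 i ^+ mn i).
  have Sexp (h : 'I_3) e n g : S n g -> S (e + n)%N (fun x => x 0 h ^+ e * g x).
    elim: e => [|e IH] Sg; first by under eq_fun => x do rewrite mul1r.
    by under eq_fun => x do rewrite exprS -mulrA; apply/SX/IH.
  rewrite mdegE; elim: (index_enum _) => [|i s IH] /=.
    by rewrite big_nil; under [X in S _ X]eq_fun => x do rewrite big_nil.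
  rewrite big_cons; under [X in S _ X]eq_fun => x do rewrite big_cons.
  exact: Sexp.
have -> : f = (fun x => \sum_(mn <- msupp p)
    mcoeff mn p * \prod_i x 0 i ^+ mn i).
  by apply/funext => x; rewrite fp mevalE.
have : all (fun mn => mdeg mn <= m)%N (msupp p).
  by apply/allP => mn /(mmeasure_mnm_lt mdeg) lt_mn; rewrite -ltnS (leq_trans lt_mn).
elim: (msupp p) => [_|mn s IH /andP[mnm /IH Ss]].
  by under eq_fun => x do rewrite big_nil.
by under eq_fun => x do rewrite big_cons; apply: SD => //; apply: Sn (Smon mn).
Qed.

Lemma Pk0P f : Pk 0 f <-> exists c, f = fun=> c.
Proof.
split=> [|[c ->]]; last exact: Pk_cst.
pose S m : set (E -> R) :=
  if m is 0%N then [set f | exists c, f = fun=> c] else setT.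
have SP : Pk 0 `<=` S 0%N.
  apply: Pk_min; rewrite /S.
  - by case=> //; exists 0.
  - move=> [|//] a h1 h2 [c1 ->] [c2 ->]; by exists (a * c1 + c2).
  - by exists 1.
  - by [].
  - by [].
exact: SP.
Qed.

Lemma sum4 (V : zmodType) (F : 'I_4 -> V) : \sum_i F i = F 0 + F 1 + F 2 + F 3.
Proof.
rewrite !big_ord_recl big_ord0 addr0 !addrA.
by congr (_ + _ + _ + _); congr F; apply: val_inj.
Qed.

(** Bernstein form: 1 is the sum of the barycentric coordinates and each
    Cartesian coordinate is a combination of them, so every monomial of degree at
    most m becomes homogeneous of degree m in them. *)
Lemma Pk_Bernstein T (m : nat) f : (m <= 2)%N -> Pk m f ->
  match m with
  | 0 => exists c, f = fun=> c
  | 1 => exists a : 'I_4 -> R, f = fun x => \sum_j a j * bary T j x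
  | _ => exists A : 'I_4 -> 'I_4 -> R,
      f = fun x => \sum_j \sum_k A j k * (bary T j x * bary T k x)
  end.
Proof.
pose S m : set (E -> R) := match m with
  | 0%N => [set f | exists c, f = fun=> c]
  | 1%N => [set f | exists a : 'I_4 -> R, f = fun x => \sum_j a j * bary T j x]
  | 2%N => [set f | exists A : 'I_4 -> 'I_4 -> R,
      f = fun x => \sum_j \sum_k A j k * (bary T j x * bary T k x)]
  | _ => setT
  end.
have coordE x (h : 'I_3) : x 0 h = \sum_j T j 0 h * bary T j x.
  rewrite {1}(bary_point T x) summxE.
  by apply: eq_bigr => j _; rewrite mxE mulrC.
suff SP : Pk m `<=` S m by case: m SP => [|[|[|m]]] // SP _ /SP.
apply: Pk_min.
- move=> [|[|[|//]]]; rewrite /S /=.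
  + by exists 0.
  + by exists (fun=> 0); apply/funext => x; rewrite big1 // => j; rewrite mul0r.
  + exists (fun _ _ => 0); apply/funext => x; rewrite big1 // => j _.
    by rewrite big1 // => k; rewrite mul0r.
- move=> [|[|[|//]]] a f1 f2; rewrite /S /=.
  + by move=> [c1 ->] [c2 ->]; exists (a * c1 + c2).
  + move=> [a1 ->] [a2 ->]; exists (fun j => a * a1 j + a2 j).
    apply/funext => x; rewrite mulr_sumr -big_split /=.
    by apply: eq_bigr => j _; ring.
  + move=> [A1 ->] [A2 ->]; exists (fun j k => a * A1 j k + A2 j k).
    apply/funext => x; rewrite mulr_sumr -big_split /=.
    apply: eq_bigr => j _; rewrite mulr_sumr -big_split /=.
    by apply: eq_bigr => k _; ring.
- by exists 1.
- move=> [|[|//]] i f1; rewrite /S /=.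
  + move=> [c ->]; exists (fun j => c * T j 0 i); apply/funext => x.
    by rewrite coordE mulr_suml; apply: eq_bigr => j _; ring.
  + move=> [a ->]; exists (fun j k => T j 0 i * a k); apply/funext => x.
    rewrite coordE mulr_suml; apply: eq_bigr => j _; rewrite mulr_sumr.
    by apply: eq_bigr => k _; ring.
- move=> [|[|//]] f1; rewrite /S /=.
  + move=> [c ->]; exists (fun=> c); apply/funext => x.
    by rewrite -mulr_sumr sum_bary mulr1.
  + move=> [a ->]; exists (fun j _ => a j); apply/funext => x.
    apply: eq_bigr => j _; rewrite -mulr_sumr -mulr_sumr sum_bary.
    by rewrite mulr1.
Qed.

Lemma Pk1P T f : Pk 1 f <->
  exists a : 'I_4 -> R, f = fun x => \sum_j a j * bary T j x.
Proof.
split=> [/(@Pk_Bernstein T 1 f isT)//|[a ->]].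
by apply: Pk_sum => j; apply: PkZ; exact: Pk_bary.
Qed.

(** A quadratic polynomial is an affine function plus a combination of the
    six edge bubbles; this form separates its values at the vertices from its
    deviation from the affine interpolant at the edge midpoints. *)
Definition quad T (a : 'I_4 -> R) (e : 'I_4 * 'I_4 -> R) : E -> R := fun x =>
  \sum_j a j * bary T j x + \sum_(p <- idxS) e p * (bary T p.1 x * bary T p.2 x).

Lemma quadE T a e x : quad T a e x =
  a 0 * bary T 0 x + a 1 * bary T 1 x + a 2 * bary T 2 x + a 3 * bary T 3 x +
  (e (0, 1) * (bary T 0 x * bary T 1 x) + e (0, 2) * (bary T 0 x * bary T 2 x) +
   e (0, 3) * (bary T 0 x * bary T 3 x) + e (1, 2) * (bary T 1 x * bary T 2 x) +
   e (1, 3) * (bary T 1 x * bary T 3 x) + e (2, 3) * (bary T 2 x * bary T 3 x)).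
Proof.
by rewrite /quad sum4 /idxS !big_cons big_nil /= addr0 !addrA.
Qed.

Lemma bary3E T x : bary T 3 x = 1 - bary T 0 x - bary T 1 x - bary T 2 x.
Proof. by rewrite -(sum_bary T x) sum4; ring. Qed.

Lemma Pk2P T f : Pk 2 f <-> exists a e, f = quad T a e.
Proof.
split=> [/(@Pk_Bernstein T 2 f isT) [A ->]|[a [e ->]]].
  (* Squares are traded for bubbles: the square of a barycentric coordinate is
     the coordinate minus its products with the other three. *)
  exists (fun j => A j j), (fun p => A p.1 p.2 + A p.2 p.1 - A p.1 p.1 - A p.2 p.2).
  apply/funext => x; rewrite quadE /= sum4 !sum4 bary3E; ring.
apply: PkD; apply: Pk_sum => j; apply: PkZ; first exact: Pk_bary.
by apply: (@PkM 1 1); exact: Pk_bary.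
Qed.

Definition edge_point T p (t : R) : E :=
  \sum_k ((k == p.1)%:R * t + (k == p.2)%:R * (1 - t)) *: T k.

Lemma bary_edge_point T p (t : R) j :
  bary T j (edge_point T p t) = (j == p.1)%:R * t + (j == p.2)%:R * (1 - t).
Proof.
have sum1 i : \sum_k (k == i)%:R = 1 :> R.
  by rewrite (bigD1 i) //= eqxx big1 ?addr0 // => k /negPf ->.
by rewrite bary_comb // big_split /= -!mulr_suml !sum1 !mul1r addrC subrK.
Qed.

Lemma idxS_neq p : p \in idxS -> p.1 != p.2.
Proof. by rewrite !inE => /or4P[||| /or3P[]] /eqP ->. Qed.

Lemma quad_vertex T a e k : quad T a e (T k) = a k.
Proof.
rewrite /quad (bigD1 k) //= bary_vertex eqxx mulr1 big1 => [|j /negPf jk].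
  rewrite big1_seq ?addr0 // => p /= /idxS_neq; rewrite !bary_vertex.
  by have [->|] := eqVneq p.1 k; rewrite 1?eq_sym ?mul0r ?mulr0 // => /negPf ->;
    rewrite !mulr0.
by rewrite bary_vertex jk mulr0.
Qed.

Lemma quad_midpoint T a e p : p \in idxS ->
  quad T a e (edge_point T p 2^-1) = (a p.1 + a p.2) / 2 + e p / 4.
Proof.
by rewrite !inE => /or4P[||| /or3P[]] /eqP ->;
  rewrite quadE !bary_edge_point /=; field.
Qed.

Lemma quad_face_div T i a e : (forall x, face T i x -> quad T a e x = 0) ->
  exists2 l, Pk 1 l & forall x, quad T a e x = bary T i x * l x.
Proof.
move=> f0; have a0 k : k != i -> a k = 0.
  move=> ki; rewrite -(quad_vertex T a e) f0 //; apply/faceP; split.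
    by apply/bodyP => j; rewrite bary_vertex.
  by rewrite bary_vertex eq_sym (negPf ki).
have e0 p : p \in idxS -> p.1 != i -> p.2 != i -> e p = 0.
  move=> pS p1 p2; have : quad T a e (edge_point T p 2^-1) = 0.
    apply: f0; apply/faceP; split.
      by apply/bodyP => j; rewrite bary_edge_point addr_ge0 ?mulr_ge0 //; lra.
    by rewrite bary_edge_point ![i == _]eq_sym (negPf p1) (negPf p2) !mul0r addr0.
  rewrite quad_midpoint // a0 // a0 // addr0 mul0r add0r => /eqP.
  by rewrite mulf_eq0 invr_eq0 pnatr_eq0 orbF => /eqP.
exists (fun x => a i + \sum_(p <- idxS) e p *
    (if p.1 == i then bary T p.2 x else
     if p.2 == i then bary T p.1 x else 0)) => [|x].
  apply: PkD; first exact: Pk_cst.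
  apply: Pk_sum => p; apply: PkZ.
  by case: (p.1 == i); [|case: (p.2 == i)];
    [exact: Pk_bary|exact: Pk_bary|exact: Pk_cst].
rewrite /quad (bigD1 i) //= big1 ?addr0 => [|k /a0 ->]; last by rewrite mul0r.
rewrite mulrDr mulrC mulr_sumr; congr (_ + _).
apply: eq_big_seq => p pS.
have [<-|p1] := eqVneq p.1 i; first by ring.
have [<-|p2] := eqVneq p.2 i; first by ring.
by rewrite e0 // !mul0r mulr0.
Qed.

(** A polynomial that vanishes on a face is divisible by the barycentric
    coordinate of the opposite vertex: its values at the vertices and edge
    midpoints of that face kill every other term. *)
Lemma Pk_face_div T i m f : (0 < m <= 2)%N -> Pk m f ->
  (forall x, face T i x -> f x = 0) ->
  exists2 l, Pk m.-1 l & forall x, f x = bary T i x * l x.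
Proof.
case: m => [|[|[|//]]] // _ Pf f0; last first.
  by have [a [e fE]] := (Pk2P T f).1 Pf; subst f; exact: quad_face_div f0.
have [a fE] := (Pk1P T f).1 Pf.
exists (fun=> a i) => [|x]; first exact: Pk_cst.
rewrite fE (bigD1 i) //= big1 ?addr0 1?mulrC // => k ki.
suff -> : a k = 0 by rewrite mul0r.
have : f (T k) = 0.
  apply/f0/faceP; rewrite bary_vertex eq_sym (negPf ki); split=> //.
  by apply/bodyP => j; rewrite bary_vertex.
rewrite fE (bigD1 k) //= bary_vertex eqxx mulr1 big1 ?addr0 // => j /negPf jk.
by rewrite bary_vertex jk mulr0.
Qed.

End Polynomials.

(** * Measures rescaled by coordinatewise affine maps *)

Section Scaling.
Variable R : realType.

(** The map h multiplies the measure of sets by the Jacobian factor c; the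
    preimage form is the one that composes with products and with
    pushforwards. *)
Definition scales d (T : measurableType d) (m : {measure set T -> \bar R})
    (h : T -> T) (c : R) : Prop :=
  measurable_fun setT h /\
  forall A, measurable A -> m A = (c%:E * m (h @^-1` A))%E.

Lemma scaled_pushforward d (T : measurableType d)
    (m : {measure set T -> \bar R}) (h : T -> T) (c : R) :
  measurable_fun setT h -> 0 <= c ->
  exists m' : {measure set T -> \bar R},
    forall A, m' A = (c%:E * m (h @^-1` A))%E.
Proof.
move=> mh c0.
by exists (mscale (NngNum c0)
  (measure_function_pushforward__canonical__measure_function_Measure m mh)).
Qed.

Lemma lebesgue_measure_scales (a r : R) : 0 < r ->
  scales (@lebesgue_measure R) (fun x => a + r * (x - a)) r.
Proof.
move=> r0; set h := (X in scales _ X _).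
have mh : measurable_fun setT (h : measurableTypeR R -> measurableTypeR R).
  by apply: measurable_funD => //; apply: measurable_funM => //; exact: measurable_funB.
split=> // A mA.
have [m' m'E] := scaled_pushforward (@lebesgue_measure R) mh (ltW r0).
rewrite -m'E; apply: lebesgue_measure_unique => // _ [[u v] _ <-] /=.
rewrite m'E.
have -> : h @^-1` `]u, v] = `](a + (u - a) / r), (a + (v - a) / r)]%classic.
  apply/seteqP; split=> x /=; rewrite !in_itv /= /h.
    move=> /andP[ux xv]; rewrite -ltrBrDl -lerBlDl ltr_pdivrMr // ler_pdivlMr //.
    by rewrite ![(x - a) * r]mulrC ltrBlDl lerBrDl ux.
  move=> /andP[]; rewrite -ltrBrDl -lerBlDl ltr_pdivrMr // ler_pdivlMr //.
  by rewrite ![(x - a) * r]mulrC ltrBlDl lerBrDl => -> ->.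
rewrite lebesgue_measure_itv [X in _ = (_ * X)%E]lebesgue_measure_itv /=.
rewrite !lte_fin ltrD2l ltr_pM2r ?invr_gt0 // ltrD2r.
case: ifP => _; last by rewrite mule0.
rewrite -!EFinB -EFinM; congr (_%:E).
by field; rewrite gt_eqF.
Qed.

Lemma product_measure_scales d1 d2 (T1 : measurableType d1)
    (T2 : measurableType d2) (m1 : {sigma_finite_measure set T1 -> \bar R})
    (m2 : {sigma_finite_measure set T2 -> \bar R}) h1 h2 c1 c2 :
  0 <= c1 -> 0 <= c2 -> scales m1 h1 c1 -> scales m2 h2 c2 ->
  scales (m1 \x m2)%E (fun x => (h1 x.1, h2 x.2)) (c1 * c2).
Proof.
move=> c10 c20 [mh1 s1] [mh2 s2]; set h := (X in scales _ X _).
have mh : measurable_fun setT h.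
  by apply: measurable_fun_pair; [apply: (measurableT_comp mh1)|
    apply: (measurableT_comp mh2)].
split=> // A mA.
have [m' m'E] := scaled_pushforward (m1 \x m2)%E mh (mulr_ge0 c10 c20).
rewrite -m'E; apply: product_measure_unique => // {mA}A B mA mB; rewrite m'E.
have -> : h @^-1` (A `*` B) = (h1 @^-1` A) `*` (h2 @^-1` B) by [].
rewrite [X in (_ * X)%E = _]product_measure1E; last 2 first.
- by rewrite -[X in measurable X]setTI; exact: mh1.
- by rewrite -[X in measurable X]setTI; exact: mh2.
by rewrite EFinM muleACA -s1 // -s2.
Qed.

Lemma scales_integral d (T : measurableType d)
    (m : {measure set T -> \bar R}) h c D (f : T -> \bar R) :
  0 <= c -> scales m h c -> measurable D -> measurable_fun D f ->
  (forall x, D x -> 0 <= f x)%E ->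
  (\int[m]_(x in D) f x = c%:E * \int[m]_(x in h @^-1` D) f (h x))%E.
Proof.
move=> c0 [mh sh] mD mf f0.
pose h' : {mfun T >-> T} := HB.pack h (isMeasurableFun.Build _ _ _ _ _ mh).
pose m' := mscale (NngNum c0) (pushforward m h).
have -> : (\int[m]_(x in D) f x =
    \int[m' mh]_(x in D) f x)%E.
  by apply: eq_measure_integral => A mA _; exact: sh.
rewrite ge0_integral_mscale //= ge0_integral_pushforward //.
by move=> x; rewrite inE; exact: f0.
Qed.

Lemma sigma_finite_leb2 :
  sigma_finite setT (@lebesgue_measure R \x @lebesgue_measure R)%E.
Proof.
pose I n : set R := `[- n%:R, n%:R]%classic.
exists (fun n => I n `*` I n) => [|n].
  apply/seteqP; split=> // -[x y] _.
  exists (Num.truncn (`|x| + `|y|)).+1 => //=.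
  have xy : `|x| + `|y| <= (Num.truncn (`|x| + `|y|)).+1%:R.
    apply: ltW; apply: truncnS_gt.
  rewrite /I /= !in_itv /= -!ler_norml.
  by split; apply: (le_trans _ xy); rewrite ?lerDl ?lerDr.
split; first by apply: measurableX; rewrite /I.

have Ioo : (@lebesgue_measure R (I n) < +oo)%E.
  by rewrite lebesgue_measure_itv /=; case: ifP => _ //; rewrite -EFinB ltry.
rewrite [X in (X < _)%E]product_measure1E; [|by rewrite /I..].
by rewrite lte_mul_pinfty // ge0_fin_numE.
Qed.

(** The plane measure has to be bundled with its sigma-finiteness for the product
    rule above to apply once more with the third coordinate. *)
Lemma leb2_sigma_finite_measure :
  exists m : {sigma_finite_measure
      set (measurableTypeR R * measurableTypeR R)%type -> \bar R},
    (@lebesgue_measure R \x @lebesgue_measure R)%E = m.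
Proof.
pose s := Measure_isSigmaFinite.Build _ _ _ _ sigma_finite_leb2.
pose m : {sigma_finite_measure
    set (measurableTypeR R * measurableTypeR R)%type -> \bar R} :=
  HB.pack (@lebesgue_measure R \x @lebesgue_measure R)%E s.
by exists m.
Qed.

End Scaling.

(** * Measurability and volume of the body *)

Section Body.
Variable R : realType.
Local Notation E := 'rV[R]_3.
Implicit Types (T : tetrahedron R) (i j k : 'I_4) (x y : E) (f g : E -> R).
Implicit Types (p : R * R * R).

Lemma measurable_coord (h : 'I_3) :
  measurable_fun setT
    (fun p : measurableTypeR R * measurableTypeR R * measurableTypeR R =>
       vec3 p 0 h).
Proof.
have m1 := @measurable_fst _ _ (measurableTypeR R * measurableTypeR R)%type
  (measurableTypeR R).
case: h => [[|[|[|//]]] hh]; under eq_fun => p do rewrite mxE /=.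
- by apply: measurableT_comp m1; exact: measurable_fst.
- by apply: measurableT_comp m1; exact: measurable_snd.
- exact: measurable_snd.
Qed.

Lemma measurable_bary T j : measurable_fun setT (fun p => bary T j (vec3 p)).
Proof.
have -> : (fun p => bary T j (vec3 p)) = (fun p => bary T j 0 +
    \sum_(i <- index_enum 'I_3) vec3 p 0 i * bary_grad T j 0 i).
  apply/funext => p; rewrite -[LHS](subrK (bary T j 0)) bary_diff subr0 addrC.
  by rewrite dotE.
apply: measurable_funD => //; apply: measurable_sum => i.
by apply: measurable_funM => //; exact: measurable_coord.
Qed.

Lemma measurable_bary_ge T j (r : R) :
  measurable [set p | r <= bary T j (vec3 p)].
Proof.
rewrite -[X in measurable X]setTI.
apply: (@measurable_fun_le _ _ _ setT (cst r) (fun p => bary T j (vec3 p))) => //.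
exact: measurable_bary.
Qed.

Lemma measurable_body T : measurable (@vec3 R @^-1` body T).
Proof.
have -> : @vec3 R @^-1` body T =
    \bigcap_(j in [set: 'I_4]) [set p | 0 <= bary T j (vec3 p)].
  apply/seteqP; split=> p /=; first by move=> /bodyP bp j _; exact: bp.
  by move=> bp; apply/bodyP => j; exact: bp.
apply: fin_bigcap_measurable => [|j _]; first exact: finite_finset.
exact: measurable_bary_ge.
Qed.

Definition box (a : E) (r : R) : set (R * R * R) :=
  (`[a 0 0, a 0 0 + r]%classic `*` `[a 0 1, a 0 1 + r]%classic)
    `*` `[a 0 2, a 0 2 + r]%classic.

Lemma boxP a r p : box a r p <-> forall h, a 0 h <= vec3 p 0 h <= a 0 h + r.
Proof.
rewrite /box /= !in_itv /=; split=> [[[p0 p1] p2] h|pb].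
  case: h => [[|[|[|//]]] hh].
  - have -> : Ordinal hh = 0 by apply: val_inj.
    by rewrite mxE.
  - have -> : Ordinal hh = 1 by apply: val_inj.
    by rewrite mxE.
  - have -> : Ordinal hh = 2 by apply: val_inj.
    by rewrite mxE.
by have := (pb 0, pb 1, pb 2); rewrite !mxE /= => -[[]].
Qed.

Lemma measurable_box a r : measurable (box a r).
Proof. by apply: measurableX => //; exact: measurableX. Qed.

Lemma leb3_box a r : 0 <= r -> leb3 (box a r) = (r ^+ 3)%:E.
Proof.
move=> r0.
have itvE (s : R) : lebesgue_measure `[s, s + r]%classic = r%:E.
  rewrite lebesgue_measure_itv /= lte_fin ltrDl -EFinB [s + r]addrC addrK.
  by case: ltgtP r0 => // <-.
rewrite /leb3 [LHS]product_measure1E //; last exact: measurableX.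
rewrite [X in (X * _)%E]product_measure1E // [X in (X * _ * _)%E]itvE.
rewrite [X in (_ * X * _)%E]itvE [X in (_ * _ * X)%E]itvE -!EFinM.
by rewrite !exprS mulr1 mulrA.
Qed.

Lemma body_bounded T :
  exists2 B : R, 0 < B & forall x (h : 'I_3), body T x -> `|x 0 h| <= B.
Proof.
exists (\sum_(i < 3) \sum_(j < 4) `|T j 0 i| + 1) => [|x i bx].
  by rewrite ltr_wpDl // sumr_ge0 // => i _; rewrite sumr_ge0.
rewrite {1}(bary_point T x) summxE (le_trans (ler_norm_sum _ _ _)) //.
rewrite (le_trans (y := \sum_(j < 4) `|T j 0 i|)) //; last first.
  rewrite (bigD1 i) //= -addrA lerDl addr_ge0 // sumr_ge0 // => h _.
  by rewrite sumr_ge0.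
apply: ler_sum => j _; rewrite mxE normrM ler_piMl //.
have /bodyP b0 := bx; rewrite ger0_norm // -(sum_bary T x) (bigD1 j) //=.
by rewrite lerDl sumr_ge0.
Qed.

Lemma leb3_body_fin T : (leb3 (@vec3 R @^-1` body T) < +oo)%E.
Proof.
have [B B0 xB] := body_bounded T.
apply: le_lt_trans (ltry ((2 * B) ^+ 3)).
rewrite -(@leb3_box (const_mx (- B))) ?mulr_ge0 ?(ltW B0) //.
apply: le_measure; rewrite ?inE;
  [exact: measurable_body|exact: measurable_box|].
move=> p bp; apply/boxP => h; have := xB (vec3 p) h bp.
by rewrite ler_norml [const_mx _ _ _]mxE; have -> : - B + 2 * B = B by ring.
Qed.

(** All barycentric coordinates equal 1/4 at the barycenter b, so a small enough
    cube with corner b stays in the body. *)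
Lemma leb3_body_gt0 T : (0 < leb3 (@vec3 R @^-1` body T))%E.
Proof.
pose b : E := \sum_k 4^-1 *: T k.
have bE j : bary T j b = 4^-1.
  by rewrite bary_comb // sum4; field.
(* Along the cube of side 1 / (4 G) each barycentric coordinate decreases by at
   most 1/4. *)
pose G : R := 1 + \sum_j \sum_h `|bary_grad T j 0 h|.
have G0 : 0 < G by rewrite ltr_pwDl // sumr_ge0 // => j _; rewrite sumr_ge0.
have r0 : 0 < (4 * G)^-1 by rewrite invr_gt0 mulr_gt0.
apply: (@lt_le_trans _ _ (leb3 (box b (4 * G)^-1))).
  by rewrite leb3_box ?(ltW r0) // lte_fin exprn_gt0.
apply: le_measure; rewrite ?inE;
  [exact: measurable_box|exact: measurable_body|].
move=> p /boxP bp; apply/bodyP => j.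
rewrite -[bary _ _ _](subrK (bary T j b)) bary_diff bE -lerBlDr sub0r dotE.
rewrite lerNl -sumrN (le_trans (y := (4 * G)^-1 * G)) //; last first.
  by rewrite invfM -mulrA mulVf ?gt_eqF // mulr1.
rewrite (le_trans (y := (4 * G)^-1 * \sum_h `|bary_grad T j 0 h|)) //.
  rewrite mulr_sumr; apply: ler_sum => h _.
  rewrite (le_trans (ler_norm _)) // normrN normrM ler_wpM2r // !mxE.
  have /andP[lo hi] := bp h; move: lo hi; rewrite !mxE => lo hi.
  by rewrite ger0_norm ?subr_ge0 // lerBlDl.
rewrite ler_wpM2l ?(ltW r0) // /G (bigD1 j) //= addrCA lerDl addr_ge0 //.
by rewrite sumr_ge0 // => k _; rewrite sumr_ge0.
Qed.

Lemma volume_gt0 T : 0 < volume (body T).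
Proof. by rewrite fine_gt0 // leb3_body_gt0 leb3_body_fin. Qed.

End Body.

(** * Moments of barycentric coordinates *)

Section Moments.
Variable R : realType.
Local Notation E := 'rV[R]_3.
Local Notation body3 T := (@vec3 R @^-1` body T).
Implicit Types (T : tetrahedron R) (i j k : 'I_4) (x y : E) (f g : E -> R).
Implicit Types (p : R * R * R).

(** Coordinates are bounded on the body, so this property is inherited by all
    polynomials. *)
Lemma Pk_measurable_bounded T m f : Pk m f ->
  measurable_fun setT (fun p => f (vec3 p)) /\
  exists B, forall x, body T x -> `|f x| <= B.
Proof.
pose S : nat -> set (E -> R) := fun=> [set f : E -> R |
  measurable_fun setT (fun p => f (vec3 p)) /\
  exists B, forall x, body T x -> `|f x| <= B].
apply: (@Pk_min R S) => //; rewrite /S /=.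
- by split=> //; exists 0 => x _; rewrite normr0.
- move=> _ a f1 f2 [m1 [B1 b1]] [m2 [B2 b2]]; split.
    by apply: measurable_funD => //; apply: measurable_funM.
  exists (`|a| * B1 + B2) => x bx; rewrite (le_trans (ler_normD _ _)) //.
  by rewrite normrM lerD ?ler_wpM2l ?b1 ?b2.
- by split=> //; exists 1 => x _; rewrite normr1.
- move=> _ h f1 [m1 [B1 b1]]; split.
    by apply: measurable_funM => //; exact: measurable_coord.
  have [B B0 xB] := body_bounded T.
  by exists (B * B1) => x bx; rewrite normrM ler_pM ?xB ?b1.
Qed.

Lemma Pk_integrable T m f : Pk m f ->
  (@leb3 R).-integrable (body3 T) (fun p => (f (vec3 p))%:E).
Proof.
move=> /(Pk_measurable_bounded T) [mf [B bf]].
apply: measurable_bounded_integrable.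
- exact: measurable_body.
- exact: leb3_body_fin.
- exact: measurable_funS mf.
- exists B; split; first exact: num_real.
  by move=> M BM p /= bp; rewrite (le_trans (bf _ bp)) // ltW.
Qed.

Lemma integral3D T m f g : Pk m f -> Pk m g ->
  integral3 (body T) (fun x => f x + g x) =
  integral3 (body T) f + integral3 (body T) g.
Proof.
move=> Pf Pg; apply: RintegralD;
  [exact: measurable_body|exact: Pk_integrable Pf|exact: Pk_integrable Pg].
Qed.

Lemma integral3Z T m (a : R) f : Pk m f ->
  integral3 (body T) (fun x => a * f x) = a * integral3 (body T) f.
Proof.
by move=> Pf; apply: RintegralZl; [exact: measurable_body|exact: Pk_integrable Pf].
Qed.

Lemma integral3_cst T (c : R) : integral3 (body T) (fun=> c) = c * volume (body T).
Proof. by apply: Rintegral_cst; exact: measurable_body. Qed.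

Lemma integral3_sum T m (I : Type) (s : seq I) (F : I -> E -> R) :
  (forall h, Pk m (F h)) ->
  integral3 (body T) (fun x => \sum_(h <- s) F h x) =
  \sum_(h <- s) integral3 (body T) (F h).
Proof.
move=> PF; elim: s => [|h s IH].
  rewrite big_nil; under [X in integral3 _ X]eq_fun => x do rewrite big_nil.
  by rewrite integral3_cst mul0r.
rewrite big_cons; under [X in integral3 _ X]eq_fun => x do rewrite big_cons.
by rewrite (integral3D T (PF h)) ?IH //; exact: Pk_sum.
Qed.

Definition homothety T j (r : R) x : E := T j + r *: (x - T j).

Lemma bary_homothety T j r i x :
  bary T i (homothety T j r x) = (i == j)%:R * (1 - r) + r * bary T i x.
Proof.
rewrite -[LHS](subrK (bary T i (T j))) bary_diff /homothety [_ + _ - _]addrC addKr.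
by rewrite dotZl dot_vertex bary_vertex; ring.
Qed.

(** A homothety acts on each coordinate separately, by an affine map of
    slope r. *)
Lemma homothety_scales T j r : 0 < r ->
  exists2 h, scales (@leb3 R) h (r ^+ 3) &
    forall p, vec3 (h p) = homothety T j r (vec3 p).
Proof.
move=> r0; pose h1 (i : 'I_3) t : R := T j 0 i + r * (t - T j 0 i).
have s1 (i : 'I_3) : scales (@lebesgue_measure R) (h1 i) r.
  exact: lebesgue_measure_scales.
have s2 := product_measure_scales (ltW r0) (ltW r0) (s1 0) (s1 1).
have [m mE] := leb2_sigma_finite_measure R.
have s2' : scales m (fun z => (h1 0 z.1, h1 1 z.2)) (r * r).
  by move: s2 => [mh s2]; split=> // A mA; rewrite /= -mE; exact: s2.
have [mh s3] := product_measure_scales (mulr_ge0 (ltW r0) (ltW r0)) (ltW r0) s2' (s1 2).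
exists (fun p => ((h1 0 p.1.1, h1 1 p.1.2), h1 2 p.2)).
  split=> // A mA; rewrite exprSr expr2 /leb3.
  by move: (s3 A mA); rewrite /= -mE.
move=> p; apply/rowP; case=> [[|[|[|//]]] hh]; rewrite !mxE /= /h1.
- by have -> : Ordinal hh = 0 by apply: val_inj.
- by have -> : Ordinal hh = 1 by apply: val_inj.
- by have -> : Ordinal hh = 2 by apply: val_inj.
Qed.


(** The part of the body cut off at a vertex is its image under a homothety. *)
Definition corner T j (r : R) : set (R * R * R) :=
  body3 T `&` [set p | 1 - r <= bary T j (vec3 p)].

Lemma measurable_corner T j r : measurable (corner T j r).
Proof.
by apply: measurableI; [exact: measurable_body|exact: measurable_bary_ge].
Qed.

Lemma corner_homothety T j (r : R) x : 0 < r -> r < 1 ->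
  (body T (homothety T j r x) /\ 1 - r <= bary T j (homothety T j r x)) <->
  body T x.
Proof.
move=> r0 r1; rewrite !bodyP bary_homothety eqxx mul1r lerDl pmulr_rge0 //.
split=> [[bh bj] i|bx].
  have [->//|ij] := eqVneq i j.
  by have := bh i; rewrite bary_homothety (negPf ij) mul0r add0r pmulr_rge0.
split=> // i; rewrite bary_homothety addr_ge0 ?mulr_ge0 ?ler0n ?subr_ge0 ?(ltW r0) //.
exact: ltW.
Qed.

Lemma corner_integral T j (r : R) m f : 0 < r -> r < 1 -> Pk m f ->
  (forall x, body T x -> 0 <= f x) ->
  \int[@leb3 R]_(p in corner T j r) f (vec3 p) =
  r ^+ 3 * integral3 (body T) (fun x => f (homothety T j r x)).
Proof.
move=> r0 r1 Pf f0; have [h hs hE] := homothety_scales T j r0.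
rewrite /integral3 /Rintegral.
rewrite (scales_integral _ hs (measurable_corner T j r)); first last.
- by move=> p [bp _]; rewrite lee_fin f0.
- apply/measurable_EFinP; apply: measurable_funTS.
  by have [] := Pk_measurable_bounded T Pf.
- by rewrite exprn_ge0 // ltW.
have -> : h @^-1` corner T j r = body3 T.
  apply/seteqP; split=> p /=; rewrite /corner /= !hE;
    by move/(corner_homothety T j (vec3 p) r0 r1).
under eq_integral => p _ do rewrite hE.
have r3 : 0 < r ^+ 3 by rewrite exprn_gt0.
case: (integral _ _ _) => [//||]; rewrite ?gt0_muley ?gt0_muleNy ?lte_fin //=;
  by rewrite mulr0.
Qed.


(** Passage to the limit r -> 1, made explicit by Bernoulli's inequality. *)
Lemma le_of_expr_le (a b : R) n : 0 <= a ->
  (forall r, 0 < r -> r < 1 -> r ^+ n * a <= b) -> a <= b.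
Proof.
move=> a0 rab; apply/ler_addgt0Pr => e e0.
have bernoulli (r : R) : 0 < r -> r < 1 -> 1 - n%:R * (1 - r) <= r ^+ n.
  move=> r0 r1; elim: n {rab} => [|n IH]; first by rewrite mul0r subr0.
  rewrite exprS (le_trans _ (ler_wpM2l (ltW r0) IH)) // -subr_ge0.
  have -> : r * (1 - n%:R * (1 - r)) - (1 - n.+1%:R * (1 - r)) =
    n%:R * (1 - r) ^+ 2 by rewrite -natr1; ring.
  by rewrite mulr_ge0 ?sqr_ge0.
(* With this r, n (1 - r) a is at most e. *)
pose d := n%:R * a + e + 1.
have na0 : 0 <= n%:R * a by rewrite mulr_ge0.
have d0 : 0 < d by rewrite /d; lra.
pose r := 1 - e / d.
have ed : 0 < e / d by rewrite divr_gt0.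
have ed1 : e / d < 1 by rewrite ltr_pdivrMr // mul1r /d; lra.
have r0 : 0 < r by rewrite /r; lra.
have r1 : r < 1 by rewrite /r; lra.
have := rab r r0 r1; have := ler_wpM2r a0 (bernoulli r r0 r1).
have : n%:R * a * (e / d) <= e.
  rewrite mulrCA -[leRHS]mulr1 ler_wpM2l ?(ltW e0) //.
  by rewrite ler_pdivrMr // mul1r /d; lra.
rewrite /r subKr mulrBl mul1r mulrAC; lra.
Qed.

(** Cutting the body at the level 1 - r of the j-th barycentric coordinate,
    the corner piece is a homothetic copy of the body, which expresses its
    contribution by the two integrals themselves; on the remaining slab the
    coordinate is at most 1 - r. Letting r tend to 1 gives the recursion for
    moments with respect to a vertex-homogeneous density g. *)
Lemma moment_recursion T j m (k : nat) g : Pk m g ->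
  (forall x, body T x -> 0 <= g x) ->
  (forall r x, g (homothety T j r x) = r ^+ k * g x) ->
  (k + 4)%:R * integral3 (body T) (fun x => bary T j x * g x) =
  integral3 (body T) g.
Proof.
move=> Pg g0 gh.
have Plg : Pk (1 + m) (fun x => bary T j x * g x).
  by apply: PkM => //; exact: Pk_bary.
set A := integral3 _ (fun x => _ * _); set G := integral3 _ g.
have A0 : 0 <= A.
  apply: Rintegral_ge0 => p bp; rewrite mulr_ge0 ?g0 //.
  by have /bodyP := bp; exact.
have G0 : 0 <= G by apply: Rintegral_ge0 => p bp; exact: g0.
have bounds (r : R) : 0 < r -> r < 1 ->
    r ^+ (k + 3) * ((1 - r) * G + r * A) <= A /\
    A - r ^+ (k + 3) * ((1 - r) * G + r * A) <=
      (1 - r) * (G - r ^+ (k + 3) * G).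
  move=> r0 r1.
  have cG : \int[@leb3 R]_(p in corner T j r) g (vec3 p) = r ^+ (k + 3) * G.
    rewrite (corner_integral j r0 r1 Pg) //.
    under [X in integral3 _ X]eq_fun => x do rewrite gh.
    by rewrite (integral3Z T _ Pg) mulrA -exprD addnC.
  have cA : \int[@leb3 R]_(p in corner T j r) (bary T j (vec3 p) * g (vec3 p)) =
      r ^+ (k + 3) * ((1 - r) * G + r * A).
    rewrite (corner_integral j r0 r1 Plg); last first.
      by move=> x bx; rewrite mulr_ge0 ?g0 //; have /bodyP := bx; exact.
    have -> : (fun x => bary T j (homothety T j r x) * g (homothety T j r x)) =
        (fun x => r ^+ k * (1 - r) * g x + r ^+ k * r * (bary T j x * g x)).
      by apply/funext => x; rewrite gh bary_homothety eqxx mul1r; ring.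
    rewrite (@integral3D T (1 + m)); [|by apply: PkZ; exact: Pk_le Pg|exact: PkZ].
    rewrite (integral3Z T _ Pg) (integral3Z T _ Plg) -/A -/G.
    by rewrite exprD; ring.
  pose slab := body3 T `\` corner T j r.
  have mslab : measurable slab.
    by apply: measurableD; [exact: measurable_body|exact: measurable_corner].
  have split_int f n : Pk n f -> integral3 (body T) f =
      \int[@leb3 R]_(p in corner T j r) f (vec3 p) +
      \int[@leb3 R]_(p in slab) f (vec3 p).
    move=> Pf; have eU : body3 T = corner T j r `|` slab.
      by rewrite /slab setUDr setDv setD0 setUidr // => p [].
    rewrite /integral3 {1}eU Rintegral_setU //.
    - exact: measurable_corner.
    - by rewrite -eU; exact: Pk_integrable Pf.
    - by apply/disj_setPS => p [cp [_ /(_ cp)]].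
  have islab f n : Pk n f -> (@leb3 R).-integrable slab (fun p => (f (vec3 p))%:E).
    move=> Pf; apply: integrableS (Pk_integrable T Pf) => //; last by move=> p [].
    exact: measurable_body.
  have sA := split_int _ _ Plg; have sG := split_int _ _ Pg.
  rewrite cA -/A in sA; rewrite cG -/G in sG.
  have slab_ge0 : 0 <= \int[@leb3 R]_(p in slab) (bary T j (vec3 p) * g (vec3 p)).
    apply: Rintegral_ge0 => p [bp _]; rewrite mulr_ge0 ?g0 //.
    by have /bodyP := bp; exact.
  have slab_le : \int[@leb3 R]_(p in slab) (bary T j (vec3 p) * g (vec3 p)) <=
      (1 - r) * \int[@leb3 R]_(p in slab) g (vec3 p).
    rewrite -RintegralZl //; last exact: islab Pg.
    apply: le_Rintegral => //; [exact: islab Plg|exact: islab (PkZ _ Pg)|].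
    move=> p [bp /= ncp]; rewrite ler_wpM2r ?g0 // leNgt; apply/negP => lt.
    by apply: ncp; split=> //=; exact: ltW.
  have -> : G - r ^+ (k + 3) * G = \int[@leb3 R]_(p in slab) g (vec3 p).
    by rewrite {1}sG addrAC subrr add0r.
  split; first by rewrite [leRHS]sA lerDl.
  by rewrite {1}sA addrAC subrr add0r.
have geom (r : R) n : (1 - r) * \sum_(i < n) r ^+ i = 1 - r ^+ n.
  by rewrite -[1 - r]opprB mulNr -subrX1 opprB.
set n := (k + 3)%N in bounds.
have key (r : R) : 0 < r -> r < 1 ->
    r ^+ n * G <= A * \sum_(i < n.+1) r ^+ i <= G.
  move=> r0 r1; have [lo hi] := bounds r r0 r1.
  have r1' : 0 < 1 - r by rewrite subr_gt0.
  rewrite -(ler_pM2l r1') -[X in _ && X](ler_pM2l r1').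
  rewrite ![(1 - r) * (A * _)]mulrCA geom exprS.
  by apply/andP; split; rewrite -subr_ge0; [move: lo|move: hi]; rewrite -subr_ge0;
    congr (_ <= _); ring.
have -> : (k + 4)%:R = \sum_(i < n.+1) 1 :> R.
  by rewrite sumr_const card_ord /n addnS.
apply: le_anti; apply/andP; split.
  apply: (@le_of_expr_le _ _ n) => [|r r0 r1]; first by rewrite mulr_ge0 ?sumr_ge0.
  have /andP[_] := key r r0 r1; apply: le_trans.
  rewrite mulrA [X in X <= _]mulrC ler_wpM2l // mulr_sumr.
  apply: ler_sum => i _.
  by rewrite mulr1 ler_wiXn2l ?(ltW r0) ?(ltW r1) // -ltnS.
apply: (@le_of_expr_le _ _ n) => // r r0 r1.
have /andP[lo _] := key r r0 r1; apply: le_trans lo _.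
rewrite mulrC ler_wpM2r //; apply: ler_sum => i _.
by rewrite exprn_ile1 ?(ltW r0) ?(ltW r1).
Qed.

End Moments.

Section QuadraticMoments.
Variable R : realType.
Local Notation E := 'rV[R]_3.
Implicit Types (T : tetrahedron R) (i j k : 'I_4) (x y : E) (f g : E -> R).

Lemma integral_bary T j :
  integral3 (body T) (bary T j) = volume (body T) / 4.
Proof.
have := @moment_recursion R T j 0 0 (fun=> 1) (Pk_cst 0 1) (fun _ _ => ler01)
  (fun r _ => esym (mulr1 _)).
rewrite integral3_cst mul1r => <-.
have -> : (fun x => bary T j x * 1) = bary T j.
  by apply/funext => x; rewrite mulr1.
by rewrite add0n; field.
Qed.

Lemma integral_baryM_neq T i j : i != j ->
  integral3 (body T) (fun x => bary T i x * bary T j x) = volume (body T) / 20.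
Proof.
move=> ij; suff : (1 + 4)%:R * integral3 (body T) (fun x => bary T i x * bary T j x) =
    volume (body T) / 4.
  by move=> e; apply: (mulfI (x := 5)); rewrite ?pnatr_eq0 // [LHS]e; field.
rewrite -(integral_bary T j); apply: (@moment_recursion R T i 1 1).
- exact: Pk_bary.
- by move=> x /bodyP; exact.
- by move=> r x; rewrite bary_homothety eq_sym (negPf ij) mul0r add0r.
Qed.

(** The diagonal moments follow from the others because the barycentric
    coordinates sum to 1. *)
Lemma integral_baryM T i j :
  integral3 (body T) (fun x => bary T i x * bary T j x) =
  (1 + (i == j)%:R) * volume (body T) / 20.
Proof.
have [->|ij] := eqVneq i j; last by rewrite integral_baryM_neq // addr0 mul1r.
have Pl k : Pk 2 (fun x => bary T k x * bary T j x).
  by apply: (@PkM R 1 1); exact: Pk_bary.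
have : integral3 (body T) (fun x => \sum_k bary T k x * bary T j x) =
    volume (body T) / 4.
  rewrite -(integral_bary T j); congr integral3; apply/funext => x.
  by rewrite -mulr_suml sum_bary mul1r.
rewrite (integral3_sum T _ Pl) (bigD1 j) //=.
under eq_bigr => k kj do rewrite integral_baryM_neq //.
rewrite sumr_const cardC1 card_ord /= => /(canRL (addrK _)) ->.
by field.
Qed.

Lemma integral_quad T a e : integral3 (body T) (quad T a e) =
  volume (body T) * ((\sum_j a j) / 4 + (\sum_(p <- idxS) e p) / 20).
Proof.
have Pb j : Pk 2 (bary T j) by exact: Pk_bary.
have Pl p : Pk 2 (fun x => bary T p.1 x * bary T p.2 x).
  by apply: (@PkM R 1 1); exact: Pk_bary.
rewrite (@integral3D R T 2); first last.
- by apply: Pk_sum => p; exact: PkZ.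
- by apply: Pk_sum => p; exact: PkZ.
rewrite (@integral3_sum R T 2); last by move=> j; exact: PkZ.
rewrite (@integral3_sum R T 2); last by move=> p; exact: PkZ.
rewrite mulrDr; congr (_ + _).
  rewrite mulrCA mulr_suml; apply: eq_bigr => j _.
  by rewrite (integral3Z T _ (Pb j)) integral_bary.
rewrite mulrCA mulr_suml; apply: eq_big_seq => p pS.
by rewrite (integral3Z T _ (Pl p)) integral_baryM_neq // idxS_neq.
Qed.

End QuadraticMoments.

(** * Divergence of explicit fields *)

Section Divergence.
Variable R : realType.
Local Notation E := 'rV[R]_3.
Implicit Types (T : tetrahedron R) (i j k : 'I_4) (x y z g d : E) (f : E -> R).
Implicit Types (v w : E -> E).

Lemma is_derive_affine f x z g :
  (forall y, f y - f x = dot (y - x) g) -> is_derive x z f (dot z g).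
Proof.
move=> fE; have c : (fun h : R => h^-1 *: ((f \o shift x) (h *: z) - f x)) @ 0^'
    --> dot z g.
  apply: (@cvg_trans _ ((fun=> dot z g) @ (0 : R)^')); last exact: cvg_cst.
  apply: near_eq_cvg; near=> h.
  have h0 : h != 0 by near: h; exact: nbhs_dnbhs_neq.
  rewrite /= fE addrK dotZl /GRing.scale /= mulrA mulVf ?mul1r //.
by apply: DeriveDef; [apply/cvg_ex; exists (dot z g)|exact: cvg_lim].
Unshelve. all: by end_near. Qed.

Definition has_grad f x g : Prop :=
  forall h : 'I_3, is_derive x ('e_h : E) f (g 0 h).

Lemma dot_delta (h : 'I_3) g : dot 'e_h g = g 0 h.
Proof.
rewrite dotE (bigD1 h) //= mxE !eqxx mul1r big1 ?addr0 // => l /negPf lh.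
by rewrite mxE lh mul0r.
Qed.

Lemma has_grad_affine f x g :
  (forall y, f y - f x = dot (y - x) g) -> has_grad f x g.
Proof. by move=> fE h; rewrite -dot_delta; exact: is_derive_affine. Qed.

Lemma has_grad_bary T j x : has_grad (bary T j) x (bary_grad T j).
Proof. by apply: has_grad_affine => y; exact: bary_diff. Qed.

Lemma has_gradM f1 f2 x g1 g2 : has_grad f1 x g1 -> has_grad f2 x g2 ->
  has_grad (fun y => f1 y * f2 y) x (f1 x *: g2 + f2 x *: g1).
Proof. by move=> d1 d2 h; rewrite !mxE; exact: is_deriveM. Qed.

Lemma has_gradZ (a : R) f x g :
  has_grad f x g -> has_grad (fun y => a * f y) x (a *: g).
Proof. by move=> df h; rewrite mxE; exact: is_deriveZ. Qed.

Lemma has_grad_cst (a : R) x : has_grad (fun=> a) x 0.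
Proof. by move=> h; rewrite mxE; exact: is_derive_cst. Qed.

(** [div] is defined by partial derivatives that are total functions, hence
    additive only where the fields are differentiable; this relation records
    differentiability along with the value. *)
Definition has_div v x (c : R) : Prop :=
  exists2 d : 'I_3 -> R,
    forall h, is_derive x ('e_h : E) (fun y => v y 0 h : R) (d h) &
    c = \sum_h d h.

Lemma has_divE v x c : has_div v x c -> div v x = c.
Proof.
move=> [d dv ->]; apply: eq_bigr => h _; exact: (@derive_val _ _ _ _ _ _ _ (dv h)).
Qed.

Lemma has_divD v w x c1 c2 : has_div v x c1 -> has_div w x c2 ->
  has_div (v + w) x (c1 + c2).
Proof.
move=> [d1 dv ->] [d2 dw ->]; exists (fun h => d1 h + d2 h).
  move=> h; have -> : (fun y => (v + w) y 0 h : R) =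
      (fun y => v y 0 h : R) + (fun y => w y 0 h : R).
    by apply/funext => y; rewrite mxE.
  exact: is_deriveD.
by rewrite big_split.
Qed.

Lemma has_divZ (a : R) v x c : has_div v x c -> has_div (a *: v) x (a * c).
Proof.
move=> [d dv ->]; exists (fun h => a * d h); last by rewrite mulr_sumr.
move=> h; have -> : (fun y => (a *: v) y 0 h : R) = a \*: (fun y => v y 0 h : R).
  by apply/funext => y; rewrite mxE.
exact: is_deriveZ.
Qed.

Lemma has_div0 x : has_div 0 x 0.
Proof.
exists (fun=> 0) => [h|]; last by rewrite big1.
have -> : (fun y => (0 : E -> E) y 0 h : R) = cst 0.
  by apply/funext => y; rewrite mxE.
exact: is_derive_cst.
Qed.

Lemma has_div_sum (I : eqType) (s : seq I) (v : I -> E -> E) x (c : I -> R) :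
  (forall l, l \in s -> has_div (v l) x (c l)) ->
  has_div (\sum_(l <- s) v l) x (\sum_(l <- s) c l).
Proof.
move=> dv; rewrite 2!big_seq; elim/big_rec2: _ => [|l a w ls dw].
  exact: has_div0.
by apply: has_divD => //; exact: dv.
Qed.

(** Product rule: the field x - P has divergence 3 and gradient the identity. *)
Lemma has_div_radial f x g (P : E) : has_grad f x g ->
  has_div (fun y => f y *: (y - P)) x (3 * f x + dot (x - P) g).
Proof.
move=> df; exists (fun h => f x + (x - P) 0 h * g 0 h) => [h|]; last first.
  by rewrite big_split /= -dotE sumr_const card_ord mulr_natl.
have -> : (fun y => (f y *: (y - P)) 0 h : R) =
    (fun y => f y * (y - P) 0 h) by apply/funext => y; rewrite mxE.
have dc : has_grad (fun y => (y - P) 0 h) x 'e_h.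
  by apply: has_grad_affine => y; rewrite dotC dot_delta !mxE; ring.
by apply: is_derive_eq (has_gradM df dc h) _; rewrite !mxE !eqxx mulr1.
Qed.

Lemma has_div_psi0 T j x : has_div (psi0 T j) x (volume (body T))^-1.
Proof.
have -> : (volume (body T))^-1 =
    3 * (3 * volume (body T))^-1 + dot (x - T j) 0.
  by rewrite dotC dot0l; field; rewrite gt_eqF // volume_gt0.
exact: has_div_radial (T j) (has_grad_cst _ x).
Qed.

Lemma has_div_psi1 T j x :
  has_div (psi1 T j) x ((3 * volume (body T))^-1 * (4 * bary T j x - 1)).
Proof.
have -> : psi1 T j =
    (fun y => ((3 * volume (body T))^-1 * bary T j y) *: (y - T j)).
  by apply/funext => y; rewrite /psi1 /psi0 scalerA mulrC.
have := has_div_radial (T j) (has_gradZ (3 * volume (body T))^-1 (has_grad_bary T j x)).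
rewrite dotC dotZl dotC dot_vertex eqxx; congr has_div; rewrite /=; ring.
Qed.

Lemma has_div_quadratic T i k x :
  has_div (fun y => (bary T k y * bary T i y) *: (y - T i)) x
    (5 * (bary T k x * bary T i x) - bary T k x - (k == i)%:R * bary T i x).
Proof.
have := has_div_radial (T i) (has_gradM (has_grad_bary T k x) (has_grad_bary T i x)).
rewrite dotC dotDl !dotZl ![dot (bary_grad _ _) _]dotC !dot_vertex eqxx.
congr has_div; rewrite /=; ring.
Qed.

(** This form reduces psi2 to the fields of [has_div_quadratic]. *)
Lemma psi2E T p : psi2 T p = (3 * volume (body T))^-1 *: (
  6 *: ((fun y => (bary T p.1 y * bary T p.2 y) *: (y - T p.2)) +
        (fun y => (bary T p.2 y * bary T p.1 y) *: (y - T p.1)))) +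
  (-1) *: (psi1 T p.1 + psi1 T p.2).
Proof.
apply/funext => y; rewrite /psi2 /psi1 /psi0 !fctE /=.
apply/rowP => h; rewrite !mxE; ring.
Qed.

Lemma has_div_psi2 T p x : p.1 != p.2 ->
  has_div (psi2 T p) x ((3 * volume (body T))^-1 *
    (60 * (bary T p.1 x * bary T p.2 x) - 10 * (bary T p.1 x + bary T p.2 x) + 2)).
Proof.
move=> p12; rewrite psi2E.
have := has_divD (has_divZ (3 * volume (body T))^-1 (has_divZ 6 (has_divD
  (has_div_quadratic T p.2 p.1 x) (has_div_quadratic T p.1 p.2 x))))
  (has_divZ (-1) (has_divD (has_div_psi1 T p.1 x) (has_div_psi1 T p.2 x))).
rewrite [p.2 == _]eq_sym (negPf p12); congr has_div; rewrite /=; ring.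
Qed.

End Divergence.

(** * Raviart-Thomas fields without normal flux *)

Section RaviartThomas.
Variable R : realType.
Local Notation E := 'rV[R]_3.
Implicit Types (T : tetrahedron R) (i j k : 'I_4) (x y : E) (f : E -> R).
Implicit Types (v w : E -> E).

Lemma RTint_subspace m T : is_subspace (RTint m T).
Proof.
split.
  split; last by move=> i n _ x _; rewrite dot0l.
  exists (fun=> 0), (fun=> 0); split=> [h||x].
  - by under eq_fun => x do rewrite mxE; exact: Pk_cst.
  - exact: Pk_cst.
  - by rewrite scale0r addr0.
move=> a v w [[p1 [q1 [P1 Q1 v1]]] n1] [[p2 [q2 [P2 Q2 w2]]] n2]; split.
  exists (fun x => a *: p1 x + p2 x), (fun x => a * q1 x + q2 x).
  split=> [h||x].
  - by under eq_fun => x do rewrite !mxE; apply: PkD => //; exact: PkZ.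
  - by apply: PkD => //; exact: PkZ.
  - rewrite !fctE v1 w2 scalerDr scalerDl scalerA -!addrA; congr (_ + _).
    by rewrite addrCA.
by move=> i n ni x fx; rewrite !fctE dotDl dotZl (n1 i) // (n2 i) // mulr0 addr0.
Qed.

(** On the face opposite to vertex i the factor bary T i vanishes; every other
    face contains both x and the i-th vertex, so x - T i is tangential to it. *)
Lemma RTint_bubble m T i f : Pk m f ->
  RTint m.+1 T (fun x => (f x * bary T i x) *: (x - T i)).
Proof.
move=> Pf; have Pb : Pk m.+1 (fun x => f x * bary T i x).
  by rewrite -addn1; apply: PkM => //; exact: Pk_bary.
split.
  exists (fun x => - (f x * bary T i x) *: T i), (fun x => f x * bary T i x).
  split=> // [h|x]; last by rewrite scalerBr scaleNr addrC.
  under eq_fun => x do rewrite mxE mulNr mulrC -mulNr.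
  exact: PkZ.
move=> j n nj x fx; rewrite dotZl; have [->|ij] := eqVneq i j.
  by have /faceP[_ ->] := fx; rewrite mulr0 mul0r.
by rewrite (face_tangent nj fx ij) mulr0.
Qed.

Lemma psi1_RTint m T j : RTint m.+1 T (psi1 T j).
Proof.
have -> : psi1 T j =
    (fun x => ((3 * volume (body T))^-1 * bary T j x) *: (x - T j)).
  by apply/funext => x; rewrite /psi1 /psi0 scalerA mulrC.
exact/RTint_bubble/Pk_cst.
Qed.

Lemma psi2_RTint m T p : RTint m.+2 T (psi2 T p).
Proof.
pose c := (3 * volume (body T))^-1.
pose b i k x := (c * (6 * bary T i x - 1) * bary T k x) *: (x - T k).
have Rb i k : RTint m.+2 T (b i k).
  apply: RTint_bubble; apply: PkZ; apply: PkB; last exact: Pk_cst.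
  by apply: PkZ; exact: Pk_bary.
have -> : psi2 T p = 1 *: b p.1 p.2 + b p.2 p.1.
  apply/funext => x; rewrite scale1r /psi2 /psi1 /psi0 /b !fctE /= !scalerA.
  by congr (_ *: _ + _ *: _); rewrite -/c; ring.
by have [_ RD] := RTint_subspace m.+2 T; exact: RD.
Qed.

(** The component of a field in RT_m along a barycentric gradient is a polynomial
    of degree m plus a multiple of the barycentric coordinate, so a vanishing
    normal flux makes it divisible by that coordinate. The four components
    determine the field, and as they sum to zero they determine q. *)
Lemma RTint_decomp m T v : (0 < m <= 2)%N -> RTint m T v ->
  exists2 l : 'I_4 -> E -> R, forall i, Pk m.-1 (l i) &
    v = fun x => \sum_i (l i x * bary T i x) *: (x - T i).
Proof.
move=> m12 Rv; have [[p [q [Pp Pq vE]]] _] := Rv.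
pose r i x := dot (p x) (bary_grad T i) - q x * bary T i 0.
have fluxE i x : dot (v x) (bary_grad T i) = r i x + q x * bary T i x.
  have := bary_diff T i x 0; rewrite subr0 => xg.
  by rewrite vE dotDl dotZl /r -xg; ring.
have Pr i : Pk m (r i).
  apply: PkB; last by under eq_fun => x do rewrite mulrC; exact: PkZ.
  under eq_fun => x do rewrite dotE.
  by apply: Pk_sum => h; under eq_fun => x do rewrite mulrC; exact: PkZ.
have /choice[l lP] i : exists li : E -> R,
    Pk m.-1 li /\ forall x, r i x = bary T i x * li x.
  have r0 x : face T i x -> r i x = 0.
    move=> fx; have := fluxE i x; rewrite (RTint_grad Rv fx).
    by have /faceP[_ ->] := fx; rewrite mulr0 addr0.
  by have [li Pli rE] := Pk_face_div m12 (Pr i) r0; exists li.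
exists (fun i x => - l i x) => [i|].
  have [Pl _] := lP i.
  by under eq_fun => x do rewrite -mulN1r; exact: PkZ.
apply/funext => x.
have qE : q x = - \sum_i bary T i x * l i x.
  apply/eqP; rewrite -addr_eq0 addrC; apply/eqP.
  rewrite -[RHS](sum_dot_grad T (v x)) -[q x]mulr1 -(sum_bary T x) mulr_sumr.
  rewrite -big_split /=; apply: eq_bigr => i _.
  by rewrite fluxE (lP i).2.
rewrite {1}(grad_decomp T (v x)).
under eq_bigr => i _ do rewrite fluxE (lP i).2 scalerDl -scalerA.
rewrite big_split /=.
have -> : \sum_i q x * bary T i x *: T i = q x *: x.
  transitivity (q x *: \sum_i bary T i x *: T i); last by rewrite -bary_point.
  rewrite scaler_sumr.
  by apply: eq_bigr => i _; rewrite scalerA.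
rewrite qE scaleNr scaler_suml -sumrB; apply: eq_bigr => i _.
by rewrite scalerA -scalerBr -opprB scalerN mulNr scaleNr mulrC.
Qed.

(** The multipliers in the decomposition are constants c_i. A divergence that
    vanishes at the vertices makes them all equal, and the sum of the bubble
    fields with equal multipliers is zero. *)
Lemma RTint1_divfree T v : RTint 1 T v -> divfree v -> v = 0.
Proof.
move=> Rv dv; have [l Pl vE] := RTint_decomp (isT : (0 < 1 <= 2)%N) Rv.
have /choice[c lE] i : exists c : R, l i = fun=> c by exact/Pk0P/Pl.
have {}vE : v = \sum_i c i *: (fun x => bary T i x *: (x - T i)).
  rewrite vE; apply/funext => x; rewrite fct_sumE; apply: eq_bigr => i _.
  by rewrite lE !fctE scalerA.
have divE x : div v x = \sum_i c i * (4 * bary T i x - 1).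
  apply: has_divE; rewrite vE; apply: has_div_sum => i _; apply: has_divZ.
  have := has_div_radial (T i) (has_grad_bary T i x).
  by rewrite dot_vertex eqxx; congr has_div; rewrite /=; ring.
have cE k : 4 * c k = \sum_i c i.
  have e : \sum_i c i * (4 * bary T i (T k) - 1) = 4 * c k - \sum_i c i.
    under eq_bigr => i _ do rewrite bary_vertex mulrBr mulr1.
    rewrite sumrB (bigD1 k) //= eqxx mulr1 big1 => [|i /negPf ->].
      by rewrite addr0 mulrC.
    by rewrite mulr0 mulr0.
  by apply/eqP; rewrite -subr_eq0 -e -divE dv.
have c0 i : c i = c 0.
  by apply: (@mulfI _ 4); rewrite ?pnatr_eq0 // !cE.
rewrite vE; apply/funext => x; rewrite fct_sumE.
under eq_bigr => i _ do rewrite c0 fctE.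
rewrite -scaler_sumr; under eq_bigr => i _ do rewrite scalerBr.
by rewrite sumrB -scaler_suml sum_bary scale1r -bary_point subrr scaler0.
Qed.

(** The divergence theorem for fields without normal flux, read off from the
    moments of the fields bary T k * bary T i * (x - T i) that span this space. *)
Lemma RTint2_div T v : RTint 2 T v ->
  exists2 d, Qperp T (Pk 0) d & forall x, has_div v x (d x).
Proof.
move=> Rv; have [l Pl vE] := RTint_decomp (isT : (0 < 2 <= 2)%N) Rv.
have /choice[a lE] i : exists a : 'I_4 -> R, l i = fun x => \sum_j a j * bary T j x.
  exact/Pk1P/Pl.
pose b i k x := 5 * (bary T k x * bary T i x) - bary T k x - (k == i)%:R * bary T i x.
have Pb i k : Pk 2 (b i k).
  apply: PkB; last by apply: PkZ; exact: Pk_bary.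
  apply: PkB; last exact: Pk_bary.
  by apply: PkZ; apply: (@PkM R 1 1); exact: Pk_bary.
have Ib i k : integral3 (body T) (b i k) = 0.
  have -> : b i k = fun x => (5 * (bary T k x * bary T i x) + (-1) * bary T k x) +
      - (k == i)%:R * bary T i x by apply/funext => x; rewrite /b; ring.
  have P1b j : Pk 2 (bary T j) by exact: Pk_bary.
  have P2b : Pk 2 (fun x => bary T k x * bary T i x).
    by apply: (@PkM R 1 1); exact: Pk_bary.
  rewrite (@integral3D R T 2) ?(@integral3D R T 2) ?(integral3Z T _ (P1b _))
    ?(integral3Z T _ P2b); try by do ?apply: PkD; exact: PkZ.
  by rewrite integral_baryM !integral_bary; field.
have Pd i : Pk 2 (fun x => \sum_k a i k * b i k x).
  by apply: Pk_sum => k; exact: PkZ.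
exists (fun x => \sum_i \sum_k a i k * b i k x).
  split=> [|r /Pk0P[c ->]]; first exact: Pk_sum.
  rewrite /L2dot; under [X in integral3 _ X]eq_fun => x do rewrite mulrC.
  rewrite (@integral3Z R T 2) ?(integral3_sum T _ Pd); last exact: Pk_sum.
  rewrite big1 ?mulr0 // => i _; rewrite (@integral3_sum R T 2); last first.
    by move=> k; exact: PkZ.
  by rewrite big1 // => k _; rewrite (integral3Z T _ (Pb i k)) Ib mulr0.
move=> x; have -> : v = \sum_i \sum_k a i k *:
    (fun x => (bary T k x * bary T i x) *: (x - T i)).
  rewrite vE; apply/funext => y; rewrite fct_sumE; apply: eq_bigr => i _.
  rewrite lE mulr_suml scaler_suml fct_sumE; apply: eq_bigr => k _.
  by rewrite fctE scalerA mulrA.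
apply: has_div_sum => i _; apply: has_div_sum => k _; apply: has_divZ.
exact: has_div_quadratic.
Qed.

End RaviartThomas.

(** * Spans of finite families *)

Section Spans.
Variable R : realType.
Local Notation E := 'rV[R]_3.
Implicit Types (A : set E) (v w : E -> E).

Lemma sum_map_coef (I : eqType) (s : seq I) (F : I -> E -> E)
    (c : 'I_(size (map F s)) -> R) : uniq s ->
  exists2 c' : I -> R, \sum_k c k *: (map F s)`_k = \sum_(i <- s) c' i *: F i &
    forall k, exists2 i, i \in s & c k = c' i.
Proof.
case: s c => [|i0 r] c su.
  by exists (fun=> 0); [rewrite big_nil big1 // => -[]|case].
set s := i0 :: r in c su *; pose c' i := oapp c 0 (insub (index i s)).
have lt_k (k : 'I_(size (map F s))) : (k < size s)%N by rewrite -(size_map F).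
have cE k : c k = c' (nth i0 s k) by rewrite /c' index_uniq // valK.
exists c' => [|k]; last by exists (nth i0 s k) => //; exact: mem_nth.
rewrite [RHS](big_nth i0) big_mkord -(size_map F).
by apply: eq_bigr => k _; rewrite cE (nth_map i0).
Qed.

Lemma lin_span_mapP (I : eqType) (s : seq I) (F : I -> E -> E) v : uniq s ->
  lin_span (map F s) v <-> exists c : I -> R, v = \sum_(i <- s) c i *: F i.
Proof.
move=> su; split=> [[c ->]|[c ->]].
  by have [c' -> _] := sum_map_coef c su; exists c'.
case: s su => [|i0 r] su; first by exists (fun=> 0); rewrite big_nil big1 // => -[].
exists (fun k => c (nth i0 (i0 :: r) k)).
rewrite (big_nth i0) big_mkord -(size_map F); apply: eq_bigr => k _.
by rewrite (nth_map i0) // -(size_map F).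
Qed.

Lemma lin_indep_map (I : eqType) (s : seq I) (F : I -> E -> E) A : uniq s ->
  (forall c : I -> R, (forall x, A x -> (\sum_(i <- s) c i *: F i) x = 0) ->
     forall i, i \in s -> c i = 0) ->
  lin_indep_on A (map F s).
Proof.
move=> su indep c c0 k; have [c' sumE cE] := sum_map_coef c su.
have [i si ->] := cE k; apply: indep si => x Ax.
by rewrite -sumE fct_sumE; exact: c0.
Qed.

Lemma span_add_mapP (I J : eqType) (s : seq I) (t : seq J) (F : I -> E -> E)
    (G : J -> E -> E) v : uniq s -> uniq t ->
  set_add (lin_span (map F s)) (lin_span (map G t)) v <->
  exists c d, v = \sum_(i <- s) c i *: F i + \sum_(j <- t) d j *: G j.
Proof.
move=> su tu; split=> [[u [w []]]|[c [d ->]]].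
  by move=> /(lin_span_mapP _ _ su)[c ->] /(lin_span_mapP _ _ tu)[d ->] ->; exists c, d.
exists (\sum_(i <- s) c i *: F i), (\sum_(j <- t) d j *: G j); split=> //.
  by apply/lin_span_mapP => //; exists c.
by apply/lin_span_mapP => //; exists d.
Qed.

(** Independence of two families together, with coefficients kept apart; it gives
    the independence of the concatenation as well as the directness of the sum of
    the spans. *)
Definition indep_pair (I J : eqType) (s : seq I) (t : seq J) (F : I -> E -> E)
    (G : J -> E -> E) A : Prop := forall c d,
  (forall x, A x ->
    (\sum_(i <- s) c i *: F i + \sum_(j <- t) d j *: G j) x = 0) ->
  (forall i, i \in s -> c i = 0) /\ (forall j, j \in t -> d j = 0).

Lemma indep_pair_lin_indep (I J : eqType) (s : seq I) (t : seq J)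
    (F : I -> E -> E) (G : J -> E -> E) A : uniq s -> uniq t ->
  indep_pair s t F G A -> lin_indep_on A (map F s ++ map G t).
Proof.
move=> su tu indep.
pose H (k : I + J) := match k with inl i => F i | inr j => G j end.
have -> : map F s ++ map G t = map H (map inl s ++ map inr t).
  by rewrite map_cat -!map_comp.
apply: lin_indep_map.
  rewrite cat_uniq !map_inj_uniq ?su ?tu ?andbT /=; last 2 first.
  - by move=> ? ? [].
  - by move=> ? ? [].
  by apply/hasPn => _ /mapP[j _ ->]; apply/mapP => -[].
move=> c c0; have [x Ax|ci dj] := indep (c \o inl) (c \o inr).
  by have := c0 x Ax; rewrite big_cat !big_map.
by move=> k; rewrite mem_cat => /orP[/mapP[i /ci ? ->]|/mapP[j /dj ? ->]].
Qed.

Lemma indep_pair_span_cap (I J : eqType) (s : seq I) (t : seq J)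
    (F : I -> E -> E) (G : J -> E -> E) A : uniq s -> uniq t ->
  indep_pair s t F G A ->
  lin_span (map F s) `&` lin_span (map G t) = [set 0].
Proof.
move=> su tu indep; apply/seteqP; split=> [v []|_ ->]; last first.
  split; apply/lin_span_mapP => //; exists (fun=> 0); rewrite big1 // => i _;
    by rewrite scale0r.
move=> /(lin_span_mapP _ _ su)[c ->] /(lin_span_mapP _ _ tu)[d cd] /=.
have [x _|c0 _] := indep c (fun j => - d j).
  by rewrite cd -big_split big1 // => j _; rewrite /= scaleNr addrN.
by rewrite big1_seq // => i /= /c0 ->; rewrite scale0r.
Qed.

Lemma lin_span_subspace (s : seq (E -> E)) : is_subspace (lin_span s).
Proof.
split; first by exists (fun=> 0); rewrite big1 // => i _; rewrite scale0r.
move=> a _ _ [c1 ->] [c2 ->]; exists (fun i => a * c1 i + c2 i).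
rewrite scaler_sumr -big_split; apply: eq_bigr => i _ /=.
by rewrite scalerA -scalerDl.
Qed.

Lemma set_add_subspace (X Y : set (E -> E)) :
  is_subspace X -> is_subspace Y -> is_subspace (set_add X Y).
Proof.
move=> [X0 XD] [Y0 YD]; split; first by exists 0, 0; rewrite addr0.
move=> a _ _ [x1 [y1 [Xx1 Yy1 ->]]] [x2 [y2 [Xx2 Yy2 ->]]].
exists (a *: x1 + x2), (a *: y1 + y2); split; [exact: XD|exact: YD|].
by rewrite scalerDr addrACA.
Qed.

Lemma subspace_sum (I : eqType) (s : seq I) (F : I -> E -> E) (c : I -> R)
    (X : set (E -> E)) : is_subspace X -> (forall i, i \in s -> X (F i)) ->
  X (\sum_(i <- s) c i *: F i).
Proof.
move=> [X0 XD] XF; rewrite big_seq; elim/big_rec: _ => // i x si Xx.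
by apply: XD => //; exact: XF.
Qed.

End Spans.

(** * Independence of the lowest order fields *)

Section LowestOrder.
Variable R : realType.
Local Notation E := 'rV[R]_3.
Implicit Types (T : tetrahedron R) (i j k : 'I_4) (x y : E) (f : 'I_4 -> R).

(** Both families of fields are combinations of the x - T j with scalar functions
    as coefficients. Taking components along the barycentric gradients shows that
    such a combination vanishes at x only if the coefficients are proportional to
    the barycentric coordinates of x. *)
Lemma radial_sum_eq0 T x f : \sum_j f j *: (x - T j) = 0 ->
  forall i, f i = bary T i x * \sum_j f j.
Proof.
move=> f0 i; have := dot0l (bary_grad T i); rewrite -f0 dot_suml.
under eq_bigr => j _ do rewrite dotZl dot_vertex mulrBr.
rewrite sumrB -mulr_suml mulrC => /eqP; rewrite subr_eq0 => /eqP ->.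
rewrite (bigD1 i) //= eqxx mulr1 big1 ?addr0 // => j.
by rewrite eq_sym => /negPf ->; rewrite mulr0.
Qed.

Lemma body_vertex T k : body T (T k).
Proof. by apply/bodyP => j; rewrite bary_vertex. Qed.

Lemma body_edge_point T p (t : R) : 0 <= t <= 1 -> body T (edge_point T p t).
Proof.
move=> /andP[t0 t1]; apply/bodyP => j.
by rewrite bary_edge_point addr_ge0 // mulr_ge0 // subr_ge0.
Qed.

Lemma radial_coef_neq0 T : (3 * volume (body T))^-1 != 0 :> R.
Proof. by rewrite invr_eq0 mulf_neq0 ?pnatr_eq0 // gt_eqF // volume_gt0. Qed.

(** The coefficients of the psi0 are seen at the vertices; those of the psi1 at
    the midpoints of the three edges that end in the vertex 3, whose field psi1 is
    absent. *)
Lemma RT01_indep T : indep_pair idx4 idx3 (psi0 T) (psi1 T) (body T).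
Proof.
move=> c d cd0; pose K : R := (3 * volume (body T))^-1.
pose d' j := if j == 3 then 0 else d j.
pose f x j := K * (c j + d' j * bary T j x).
have f0 x i : body T x -> f x i = bary T i x * \sum_j f x j.
  move=> bx; apply: radial_sum_eq0; rewrite -[RHS](cd0 x bx).
  rewrite !fctE !fct_sumE /idx4 /idx3 !big_cons !big_nil sum4.
  rewrite /f /d' /psi1 /psi0 !fctE /=.
  by apply/rowP => h; rewrite !mxE -/K; ring.
have K0 : K != 0 := radial_coef_neq0 T.
have fc x i : body T x -> bary T i x = 0 -> c i = 0.
  move=> bx xi; have := f0 x i bx; rewrite /f xi mulr0 mul0r addr0 => /eqP.
  by rewrite mulf_eq0 (negPf K0) => /eqP.
have c0 i : c i = 0.
  pose k : 'I_4 := if i == 0 then 1 else 0.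
  have ik : (i == k) = false by rewrite /k; case: (eqVneq i 0) => [->|/negPf].
  by apply: (fc (T k)); [exact: body_vertex|rewrite bary_vertex ik].
split=> // j j3.
have half : 0 <= (2^-1 : R) <= 1 by apply/andP; split; lra.
have {fc} := f0 _ j (body_edge_point T (j, 3) half).
suff -> : (f (edge_point T (j, 3) 2^-1) j = bary T j (edge_point T (j, 3) 2^-1) *
    \sum_i f (edge_point T (j, 3) 2^-1) i) = (K * d j / 2 = K * d j / 4).
  move=> e; apply: (mulfI K0); rewrite mulr0; lra.
rewrite sum4 /f /d' !c0.
by move: j3; rewrite !inE => /or3P[] /eqP ->; rewrite !bary_edge_point /=;
  congr (_ = _); field.
Qed.

End LowestOrder.

(** * The divergence on the two spans *)

Section DivergenceRange.
Variable R : realType.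
Local Notation E := 'rV[R]_3.
Implicit Types (T : tetrahedron R) (i j k : 'I_4) (x y : E).
Implicit Types (p : 'I_4 * 'I_4) (v w : E -> E).

Lemma idx3_uniq : uniq idx3. Proof. by []. Qed.
Lemma idx4_uniq : uniq idx4. Proof. by []. Qed.
Lemma idxS_uniq : uniq idxS. Proof. by []. Qed.

Definition span01 T := set_add (lin_span (RT0s T)) (lin_span (RT1s T)).
Definition span12 T := set_add (lin_span (RT1s T)) (lin_span (RT2s T)).

Lemma span01P T v : span01 T v <-> exists c d,
  v = \sum_(j <- idx4) c j *: psi0 T j + \sum_(j <- idx3) d j *: psi1 T j.
Proof. exact: (span_add_mapP _ _ _ idx4_uniq idx3_uniq). Qed.

Lemma span12P T v : span12 T v <-> exists c d,
  v = \sum_(j <- idx3) c j *: psi1 T j + \sum_(p <- idxS) d p *: psi2 T p.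
Proof. exact: (span_add_mapP _ _ _ idx3_uniq idxS_uniq). Qed.

Lemma div_span01 T c d :
  div (\sum_(j <- idx4) c j *: psi0 T j + \sum_(j <- idx3) d j *: psi1 T j) =
  fun x => \sum_(j <- idx4) c j * (volume (body T))^-1 +
  \sum_(j <- idx3) d j * ((3 * volume (body T))^-1 * (4 * bary T j x - 1)).
Proof.
apply/funext => x; apply: has_divE; apply: has_divD; apply: has_div_sum => j _;
  by apply: has_divZ; (exact: has_div_psi0 || exact: has_div_psi1).
Qed.

Lemma div_span01_P1 T : set_fun (span01 T) (Pk 1) (@div R).
Proof.
move=> v /span01P[c [d ->]]; rewrite div_span01.
apply: PkD; first exact: Pk_cst.
apply: Pk_sum => j; do 2 apply: PkZ; apply: PkB; last exact: Pk_cst.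
by apply: PkZ; exact: Pk_bary.
Qed.

(** An affine function is fixed by its values a at the vertices: the three
    fields psi1 produce the differences of a j and a 3, one of the fields psi0
    the mean value. *)
Lemma div_span01_surj T : set_surj (span01 T) (Pk 1) (@div R).
Proof.
move=> q /(Pk1P T)[a ->]; set V := volume (body T).
have V0 : V != 0 by rewrite gt_eqF // volume_gt0.
pose c j := if j == 0 then V * (a 0 + a 1 + a 2 + a 3) / 4 else 0.
pose d j := 3 * V * (a j - a 3) / 4.
exists (\sum_(j <- idx4) c j *: psi0 T j + \sum_(j <- idx3) d j *: psi1 T j).
  by apply/span01P; exists c, d.
rewrite div_span01; apply/funext => x; rewrite -/V /idx4 /idx3 !big_cons !big_nil sum4.
by rewrite /c /d /= bary3E; field.
Qed.

Lemma div_span01_not_inj T : ~ set_inj (span01 T) (@div R).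
Proof.
move=> inj; have mem j : psi0 T j \in span01 T.
  apply/mem_set; exists (psi0 T j), 0; rewrite addr0; split=> //.
    apply/(lin_span_mapP _ _ idx4_uniq); exists (fun i => (i == j)%:R).
    rewrite (bigD1_seq j) //=; last by case: j => [[|[|[|[|//]]]] jj].
    rewrite eqxx scale1r big1 ?addr0 // => i /negPf ->.
    by rewrite scale0r.
  by have [] := lin_span_subspace (RT1s T).
have e : psi0 T 0 = psi0 T 1.
  apply: inj (mem _) (mem _) _; apply/funext => x.
  by rewrite !(has_divE (has_div_psi0 _ _ _)).
have : psi0 T 0 (T 0) = psi0 T 1 (T 0) by rewrite e.
rewrite /psi0 subrr scaler0 => /esym/eqP.
rewrite scaler_eq0 (negPf (radial_coef_neq0 T)) /= subr_eq0 => /eqP T01.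
have := bary_vertex T 0 0; rewrite T01 bary_vertex /= => /eqP.
by rewrite eq_sym oner_eq0.
Qed.

(** The family psi1 has no field for the vertex 3, whence the zero
    coefficient there. *)
Definition span12_vertex_values T (c : 'I_4 -> R) (d : 'I_4 * 'I_4 -> R) j : R :=
  (3 * volume (body T))^-1 *
  (4 * (if j == 3 then 0 else c j) - \sum_(i <- idx3) c i +
   \sum_(p <- idxS) d p * (2 - 10 * ((j == p.1)%:R + (j == p.2)%:R))).

Lemma div_span12 T c d :
  div (\sum_(j <- idx3) c j *: psi1 T j + \sum_(p <- idxS) d p *: psi2 T p) =
  quad T (span12_vertex_values T c d)
    (fun p => (3 * volume (body T))^-1 * (60 * d p)).
Proof.
apply/funext => x; set K := _^-1.
pose D p := K *
  (60 * (bary T p.1 x * bary T p.2 x) - 10 * (bary T p.1 x + bary T p.2 x) + 2).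
transitivity (\sum_(j <- idx3) c j * (K * (4 * bary T j x - 1)) +
    \sum_(p <- idxS) d p * D p).
  apply: has_divE; apply: has_divD.
    by apply: has_div_sum => j _; apply: has_divZ; exact: has_div_psi1.
  by apply: has_div_sum => p pS; apply/has_divZ/has_div_psi2/idxS_neq.
rewrite quadE /span12_vertex_values -/K /idx3 /idxS !big_cons !big_nil /D /= bary3E.
ring.
Qed.

Lemma mem_idxS p : p \in idxS ->
  [\/ p = (0, 1), p = (0, 2) | p = (0, 3)] \/
  [\/ p = (1, 2), p = (1, 3) | p = (2, 3)].
Proof.
rewrite !inE => /or4P[/eqP ->|/eqP ->|/eqP ->|/or3P[/eqP ->|/eqP ->|/eqP ->]].
- by left; constructor 1.
- by left; constructor 2.
- by left; constructor 3.
- by right; constructor 1.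
- by right; constructor 2.
- by right; constructor 3.
Qed.

(** Along the edge (i, k) the two conditions at parameters 1/2 and 1/3 separate
    d (i, k) from the remaining coefficients, so all the d vanish; then the c
    coincide with the coefficient 0 of the absent fourth field. *)
Lemma RT12_indep T : indep_pair idx3 idxS (psi1 T) (psi2 T) (body T).
Proof.
move=> c d cd0; pose K : R := (3 * volume (body T))^-1.
have K0 : K != 0 := radial_coef_neq0 T.
pose c' j := if j == 3 then 0 else c j.
(* The combination is the sum over j of K l_j(x) b_j(x) (x - T j) with b_j the
   barycentric coordinates; m p is the contribution of psi2 p to l. *)
pose m p x j : R := (j == p.1)%:R * (6 * bary T p.2 x - 1) +
  (j == p.2)%:R * (6 * bary T p.1 x - 1).
pose l x j := c' j + \sum_(p <- idxS) d p * m p x j.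
have lE x i : body T x -> bary T i x != 0 ->
    l x i = \sum_j bary T j x * l x j.
  move=> bx xi; apply: (mulfI K0); apply: (mulfI xi).
  have rs : \sum_j (bary T j x * (K * l x j)) *: (x - T j) = 0.
    rewrite -[RHS](cd0 x bx) !fctE !fct_sumE /idxS /idx3 !big_cons !big_nil sum4.
    rewrite /l /m /c' /psi2 /psi1 /psi0 !fctE /idxS !big_cons !big_nil /=.
    by apply/rowP => h; rewrite !mxE -/K; ring.
  rewrite [LHS](radial_sum_eq0 rs i); congr (_ * _); rewrite mulr_sumr.
  by apply: eq_bigr => j _; rewrite mulrCA.
have edge p (t : R) : p \in idxS -> 0 < t < 1 ->
    l (edge_point T p t) p.1 = l (edge_point T p t) p.2.
  move=> /idxS_neq p12 /andP[t0 t1]; have bx : body T (edge_point T p t).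
    by apply: body_edge_point; rewrite !ltW.
  rewrite !lE // bary_edge_point eqxx ?(negPf p12) ?[p.2 == p.1]eq_sym ?(negPf p12) /=;
    rewrite ?mul1r ?mul0r ?addr0 ?add0r ?gt_eqF ?subr_gt0 //.
have half : 0 < (2^-1 : R) < 1 by apply/andP; split; lra.
have third : 0 < (3^-1 : R) < 1 by apply/andP; split; lra.
have d0 p : p \in idxS -> d p = 0.
  move=> pS; have := edge p _ pS third; have := edge p _ pS half; move: pS.
  rewrite /l /idxS !big_cons !big_nil /m !bary_edge_point.
  by move=> /mem_idxS[[]|[]] -> /=; lra.
split=> // j j3; have := edge (j, 3) _ _ half.
have jS : (j, 3) \in idxS by move: j3; rewrite !inE => /or3P[] /eqP ->.
move=> /(_ jS); rewrite /l !big1_seq; last 2 first.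
- by move=> p /d0 ->; rewrite mul0r.
- by move=> p /d0 ->; rewrite mul0r.
rewrite /c' /= !addr0.
by move: j3; rewrite !inE => /or3P[] /eqP ->.
Qed.

Lemma span12_subspace T : is_subspace (span12 T).
Proof. by apply: set_add_subspace; exact: lin_span_subspace. Qed.

Lemma span12_RTint T : span12 T `<=` RTint 2 T.
Proof.
move=> v /span12P[c [d ->]]; have RTsub := RTint_subspace 2 T.
rewrite -[X in X + _]scale1r; apply: RTsub.2; apply: subspace_sum => // k _.
  exact: psi1_RTint.
exact: psi2_RTint.
Qed.

Lemma div_RTint_Qperp T : set_fun (RTint 2 T) (Qperp T (Pk 0)) (@div R).
Proof.
move=> v /RTint2_div[d Qd dv].
by have -> : div v = d by apply/funext => x; exact: has_divE.
Qed.

Lemma Qperp_integral T q : Qperp T (Pk 0) q -> integral3 (body T) q = 0.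
Proof.
move=> [_ q0]; rewrite -(q0 (fun=> 1)); last exact: Pk_cst.
by rewrite /L2dot; congr integral3; apply/funext => x; rewrite mulr1.
Qed.

Lemma div_span12_inj T : set_inj (span12 T) (@div R).
Proof.
move=> v w /set_mem/span12P[c [d ->]] /set_mem/span12P[c2 [d2 ->]].
rewrite !div_span12 => e; have K0 := radial_coef_neq0 T.
have aE j : span12_vertex_values T c d j = span12_vertex_values T c2 d2 j.
  rewrite -[LHS](quad_vertex T _ (fun p => (3 * volume (body T))^-1 * (60 * d p))).
  by rewrite e quad_vertex.
have dE p : p \in idxS -> d p = d2 p.
  move=> pS; have : quad T (span12_vertex_values T c d)
    (fun p => (3 * volume (body T))^-1 * (60 * d p)) (edge_point T p 2^-1) =
    quad T (span12_vertex_values T c2 d2)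
    (fun p => (3 * volume (body T))^-1 * (60 * d2 p)) (edge_point T p 2^-1).
    by rewrite e.
  rewrite !quad_midpoint // !aE => /addrI e4.
  by apply: (@mulfI _ 60); rewrite ?pnatr_eq0 //; apply: (mulfI K0); lra.
have {}aE j : 4 * (if j == 3 then 0 else c j) - \sum_(i <- idx3) c i =
    4 * (if j == 3 then 0 else c2 j) - \sum_(i <- idx3) c2 i.
  apply: (mulfI K0); have := aE j; rewrite /span12_vertex_values !mulrDr.
  have -> : \sum_(p <- idxS) d p * (2 - 10 * ((j == p.1)%:R + (j == p.2)%:R)) =
      \sum_(p <- idxS) d2 p * (2 - 10 * ((j == p.1)%:R + (j == p.2)%:R)) :> R.
    by apply: eq_big_seq => p /dE ->.
  by move/addIr.
have cE j : j \in idx3 -> c j = c2 j.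
  move=> j3; have := aE 3; have := aE j; rewrite eqxx.
  have -> : (j == 3) = false by move: j3; rewrite !inE => /or3P[] /eqP ->.
  lra.
by congr (_ + _); apply: eq_big_seq => k; [move=> /cE ->|move=> /dE ->].
Qed.

(** The coefficients d are read off from the edge bubbles; subtracting their
    contribution leaves an affine function of mean zero with vertex values b,
    which the three fields psi1 produce. *)
Lemma div_span12_surj T : set_surj (span12 T) (Qperp T (Pk 0)) (@div R).
Proof.
move=> q Qq; have [/(Pk2P T)[a [e qE]] _] := Qq; have K0 := radial_coef_neq0 T.
have V0 : volume (body T) != 0 by rewrite gt_eqF // volume_gt0.
have := Qperp_integral Qq; rewrite {}qE {Qq}.
rewrite integral_quad => /eqP; rewrite mulf_eq0 (negPf V0) /= => /eqP ae0.
set K := (_^-1) in K0.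
pose d p := e p / (60 * K).
pose b j := a j / K -
  \sum_(p <- idxS) d p * (2 - 10 * ((j == p.1)%:R + (j == p.2)%:R)).
pose c j := (b j - b 3) / 4.
exists (\sum_(j <- idx3) c j *: psi1 T j + \sum_(p <- idxS) d p *: psi2 T p).
  by apply/span12P; exists c, d.
rewrite div_span12; congr quad; apply/funext; last first.
  by move=> p; rewrite -/K /d; field.
move=> j; rewrite /span12_vertex_values -/K.
have b0 : b 0 + b 1 + b 2 + b 3 = 0.
  have -> : b 0 + b 1 + b 2 + b 3 =
      4 / K * ((\sum_j a j) / 4 + (\sum_(p <- idxS) e p) / 20).
    by rewrite sum4 /b /idxS !big_cons !big_nil /d /=; field.
  by rewrite ae0 mulr0.
suff -> : 4 * (if j == 3 then 0 else c j) - \sum_(i <- idx3) c i = b j.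
  by rewrite subrK mulrC divfK.
have j4 : j \in idx4 by case: j => [[|[|[|[|//]]]] jj].
by move: j4; rewrite !inE => /or4P[] /eqP ->; rewrite /idx3 !big_cons !big_nil /c /=;
  lra.
Qed.

Lemma div_span12_bij T : set_bij (span12 T) (Qperp T (Pk 0)) (@div R).
Proof.
split; [|exact: div_span12_inj|exact: div_span12_surj].
by move=> v /span12_RTint; exact: div_RTint_Qperp.
Qed.

(** For a field of RT_2^int the span contains one with the same divergence, and
    their difference is divergence free. *)
Lemma span12_complement T :
  is_complement (RTint 2 T) (RTint 2 T `&` @divfree R) (span12 T).
Proof.
have RTsub := RTint_subspace 2 T; split.
- exact: span12_subspace.
- exact: span12_RTint.
- apply/seteqP; split=> [v [Sv [_ dv]]|_ ->]; last first.
    split; first exact: (span12_subspace T).1.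
    by split; [exact: RTsub.1|move=> x; exact/has_divE/has_div0].
  apply: (@div_span12_inj T); rewrite ?inE //; first exact: (span12_subspace T).1.
  by apply/funext => x; rewrite dv; apply/esym/has_divE/has_div0.
- apply/seteqP; split=> [_ [w [z [/span12_RTint Rw [Rz _] ->]]]|v Rv].
    by rewrite -[w]scale1r; exact: RTsub.2.
  have [w Sw dwv] := div_span12_surj (div_RTint_Qperp Rv).
  have Rw := span12_RTint Sw.
  exists w, (v - w); split=> //; last by rewrite addrC subrK.
  have -> : v - w = (-1) *: w + v by rewrite scaleN1r addrC.
  split; first exact: RTsub.2.
  move=> x; have [dv _ dvE] := RTint2_div Rv; have [dw _ dwE] := RTint2_div Rw.
  rewrite (has_divE (has_divD (has_divZ (-1) (dwE x)) (dvE x))).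
  rewrite -(has_divE (dwE x)) -(has_divE (dvE x)) dwv; ring.
Qed.

End DivergenceRange.

(** * Piola's transformation *)

Section Piola.
Variable R : realType.
Local Notation E := 'rV[R]_3.
Local Notation U := (unit_tetrahedron R).
Implicit Types (T : tetrahedron R) (i j k : 'I_4) (x y : E) (v w : E -> E).

Lemma piolaD T v w : piola T (v + w) = piola T v + piola T w.
Proof. by apply/funext => x; rewrite /piola !fctE mulmxDl scalerDr. Qed.

Lemma piolaZ T (a : R) v : piola T (a *: v) = a *: piola T v.
Proof.
by apply/funext => x; rewrite /piola !fctE -scalemxAl !scalerA mulrC.
Qed.

Lemma piola_sum T (I : Type) (s : seq I) (c : I -> R) (F : I -> E -> E) :
  piola T (\sum_(i <- s) c i *: F i) = \sum_(i <- s) c i *: piola T (F i).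
Proof.
have piola0 : piola T 0 = 0.
  by apply/funext => x; rewrite /piola mul0mx scaler0.
rewrite (big_morph _ (piolaD T) piola0).
by apply: eq_bigr => i _; exact: piolaZ.
Qed.

Lemma unit_edge_mx : edge_mx (unit_vertex R) = 1%:M.
Proof.
apply/row_matrixP => i.
by rewrite rowK row1 /unit_vertex liftK unlift_none subr0.
Qed.

Lemma bary_unit T j x :
  bary U j ((x - T ord0) *m invmx (edge_mx T)) = bary T j x.
Proof.
by rewrite /bary /= unit_edge_mx invmx1 mulmx1 /unit_vertex unlift_none subr0.
Qed.

Lemma unit_to_body T j x :
  ((x - T ord0) *m invmx (edge_mx T) - U j) *m edge_mx T = x - T j.
Proof.
rewrite mulmxBl mulmxKV ?edge_unitmx //.
suff -> : U j *m edge_mx T = T j - T ord0 by rewrite opprB addrA subrK.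
rewrite /= /unit_vertex; case: unliftP => [i|] ->; last by rewrite mul0mx subrr.
by rewrite -rowE rowK.
Qed.

(** The Jacobian factor of the transformation together with the normalisations
    of the fields on the two tetrahedra. *)
Definition piola_factor T : R :=
  `|\det (edge_mx T)|^-1 * (3 * volume (body U))^-1 * (3 * volume (body T)).

Lemma piola_factor_neq0 T : piola_factor T != 0.
Proof.
rewrite !mulf_neq0 ?radial_coef_neq0 // ?pnatr_eq0 //.
  by rewrite invr_eq0 normr_eq0 -unitfE -unitmxE edge_unitmx.
by rewrite gt_eqF // volume_gt0.
Qed.

Lemma piola_psi1 T j : piola T (psi1 U j) = piola_factor T *: psi1 T j.
Proof.
apply/funext => x; rewrite /piola fctE /psi1 /psi0 bary_unit -!scalemxAl.
rewrite unit_to_body !scalerA; congr (_ *: _).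
rewrite /piola_factor; set a := _^-1; set b := (3 * volume (body U))^-1.
by field; rewrite gt_eqF // volume_gt0.
Qed.

Lemma piola_psi2 T p : piola T (psi2 U p) = piola_factor T *: psi2 T p.
Proof.
apply/funext => x.
have E1 j : piola T (psi1 U j) x = piola_factor T *: psi1 T j x.
  by rewrite piola_psi1.
have mulZ (a : R) (u : E) : `|\det (edge_mx T)|^-1 *: ((a *: u) *m edge_mx T) =
    a *: (`|\det (edge_mx T)|^-1 *: (u *m edge_mx T)).
  by rewrite -scalemxAl scalerA mulrC -scalerA.
rewrite /piola fctE /psi2 !bary_unit mulmxDl scalerDr !(mulZ (_ - 1)).
rewrite [X in _ *: X + _ = _]E1 [X in _ + _ *: X = _]E1 scalerDr !scalerA.
by congr (_ *: _ + _ *: _); rewrite [_ * piola_factor T]mulrC.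
Qed.

Lemma piola_span12 T : piola T @` span12 U = span12 T.
Proof.
have a0 := piola_factor_neq0 T.
have piolaE c d : piola T (\sum_(j <- idx3) c j *: psi1 U j +
    \sum_(p <- idxS) d p *: psi2 U p) =
    \sum_(j <- idx3) (c j * piola_factor T) *: psi1 T j +
    \sum_(p <- idxS) (d p * piola_factor T) *: psi2 T p.
  rewrite piolaD !piola_sum; congr (_ + _); apply: eq_bigr => k _.
    by rewrite piola_psi1 scalerA.
  by rewrite piola_psi2 scalerA.
apply/seteqP; split=> [_ [v /span12P[c [d ->]] <-]|v /span12P[c [d ->]]].
  by rewrite piolaE; apply/span12P; do 2 eexists.
exists (\sum_(j <- idx3) (c j / piola_factor T) *: psi1 U j +
    \sum_(p <- idxS) (d p / piola_factor T) *: psi2 U p).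
  by apply/span12P; do 2 eexists.
by rewrite piolaE; congr (_ + _); apply: eq_bigr => k _; rewrite divfK.
Qed.

Lemma psi2_span12 T p : p \in idxS -> span12 T (psi2 T p).
Proof.
move=> pS; exists 0, (psi2 T p); rewrite add0r; split=> //.
  by have [] := lin_span_subspace (RT1s T).
apply/(lin_span_mapP _ _ idxS_uniq); exists (fun q => (q == p)%:R).
rewrite (bigD1_seq p) //= eqxx scale1r big1 ?addr0 // => q /negPf ->.
by rewrite scale0r.
Qed.

End Piola.

Theorem lemma2p3 (R : realType) (M : set (tetrahedron R)) :
  ((forall T, M T -> forall j, j \in idx3 -> RTint 1 T (psi1 T j)) /\
   (forall W1 : tetrahedron R -> set ('rV[R]_3 -> 'rV[R]_3),
      admissible_complements M 1 W1 ->
      forall T, M T -> forall j, j \in idx3 -> W1 T (psi1 T j)))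
  /\
  (forall T, M T ->
     let VR := set_add (lin_span (RT0s T)) (lin_span (RT1s T)) in
     lin_indep_on (body T) (RT0s T ++ RT1s T) /\
     lin_span (RT0s T) `&` lin_span (RT1s T) = [set 0] /\
     set_fun VR (Pk 1) (@div R) /\
     set_surj VR (Pk 1) (@div R) /\
     ~ set_bij VR (Pk 1) (@div R))
  /\
  (exists W2 : tetrahedron R -> set ('rV[R]_3 -> 'rV[R]_3),
     admissible_complements M 2 W2 /\
     forall T, M T -> forall p, p \in idxS -> W2 T (psi2 T p))
  /\
  (forall T, M T ->
     let VR := set_add (lin_span (RT1s T)) (lin_span (RT2s T)) in
     lin_indep_on (body T) (RT1s T ++ RT2s T) /\
     (forall j, j \in idx3 -> integral3 (body T) (div (psi1 T j)) = 0) /\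
     (forall p, p \in idxS -> integral3 (body T) (div (psi2 T p)) = 0) /\
     lin_span (RT1s T) `&` lin_span (RT2s T) = [set 0] /\
     set_bij VR (Qperp T (Pk 0)) (@div R)).
Proof.
split; [split|split; [|split]].
- by move=> T _ j _; exact: psi1_RTint.
- move=> W1 [W1c _] T MT j _; have [_ _ _ WZ] := W1c T MT.
  (* The only divergence-free field of RT_1^int is 0, so W1 T is all of it. *)
  have : RTint 1 T (psi1 T j) := psi1_RTint 0 T j.
  rewrite -{1}WZ => -[w [z [Ww [Rz dz] ->]]].
  by rewrite (RTint1_divfree Rz dz) addr0.
- move=> T _ VR; split.
    exact: (indep_pair_lin_indep idx4_uniq idx3_uniq (@RT01_indep R T)).
  split; first exact: (indep_pair_span_cap idx4_uniq idx3_uniq (@RT01_indep R T)).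
  split; first exact: div_span01_P1.
  split; first exact: div_span01_surj.
  by case=> _ /div_span01_not_inj.
(* The spans of the psi1 and psi2 serve as complements of degree 2. *)
- exists (@span12 R); split; last by move=> T _ p; exact: psi2_span12.
  split=> [T _|]; first exact: span12_complement.
  exists (span12 (unit_tetrahedron R)); split; first exact: span12_complement.
  by move=> T _; rewrite piola_span12.
- move=> T _ VR; split.
    exact: (indep_pair_lin_indep idx3_uniq idxS_uniq (@RT12_indep R T)).
  split; first by move=> j _; exact/Qperp_integral/div_RTint_Qperp/psi1_RTint.
  split; first by move=> p _; exact/Qperp_integral/div_RTint_Qperp/psi2_RTint.
  split; first exact: (indep_pair_span_cap idx3_uniq idxS_uniq (@RT12_indep R T)).
  exact: div_span12_bij.
Qed.
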